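(* Let $K$ be a commutative unital ring containing $\mathbb{Q}$ and let $(R,\Delta,\epsilon,\mu,\mathbf{1})$ be a cocommutative rack bialgebra over $K$, with $r\rhd s:=\mu(r\otimes s)$. Then the map $d_R$ of the deformation complex $C^*(R;R)$ (defined in the context) is a well-defined differential: for every $n\ge1$, $d_R^n$ maps $C^n(R;R)=\mathrm{Coder}(R^{\otimes n},R,\mu^n)$ into $C^{n+1}(R;R)=\mathrm{Coder}(R^{\otimes (n+1)},R,\mu^{n+1})$, and $d_R^{n+1}\circ d_R^n=0$.
   Context: A rack bialgebra over $K$ is a coassociative counital coalgebra $(R,\Delta,\epsilon)$ with a coaugmentation $\mathbf{1}\in R$ ($\Delta(\mathbf{1})=\mathbf{1}\otimes\mathbf{1}$, $\epsilon(\mathbf{1})=1$) and a linear map $\mu:R\otimes R\to R$, $\mu(a\otimes b)=a\rhd b$, which is a morphism of counital coaugmented coalgebras, such that for all $a,b,c$: $\mathbf{1}\rhd a=a$, $a\rhd\mathbf{1}=\epsilon(a)\mathbf{1}$, and $a\rhd(b\rhd c)=\sum_{(a)}(a^{(1)}\rhd b)\rhd(a^{(2)}\rhd c)$ (self-distributivity). It need not be associative. Cocommutative means $\Delta$ is cocommutative. Sweedler notation with suppressed sums is used: $r^{(1)}\otimes\cdots\otimes r^{(n)}$ is the iterated comultiplication. Define $\mu^1=\mathrm{id}_R$, $\mu^2=\mu$, $\mu^n=\mu\circ(\mu^1\otimes\mu^{n-1})$ for $n\ge3$, i.e. $\mu^n(r_1,\dots,r_n)=r_1\rhd(r_2\rhd(\cdots\rhd(r_{n-1}\rhd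 r_n)\cdots))$; each $\mu^n$ is a coalgebra morphism $R^{\otimes n}\to R$. For coalgebras $(C,\Delta_C)$, $(D,\Delta_D)$ and a coalgebra morphism $\phi:C\to D$, $\mathrm{Coder}(C,D,\phi)$ is the $K$-module of linear maps $f:C\to D$ with $\Delta_D\circ f=(f\otimes\phi+\phi\otimes f)\circ\Delta_C$. For $n\ge1$, $C^n(R;R):=\mathrm{Coder}(R^{\otimes n},R,\mu^n)$ and $$d_R^n:=\sum_{i=1}^n(-1)^{i+1}(d_{i,1}^n-d_{i,0}^n)+(-1)^{n+1}d_{n+1}^n,$$ where for $1\le i\le n$, $\omega\in C^n(R;R)$ and $r_1,\dots,r_{n+1}\in R$: $$d_{i,1}^n\omega(r_1,\dots,r_{n+1})=\mu^i(r_1^{(1)},\dots,r_{i-1}^{(1)},r_i)\rhd\omega(r_1^{(2)},\dots,r_{i-1}^{(2)},r_{i+1},\dots,r_{n+1}),$$ $$d_{i,0}^n\omega(r_1,\dots,r_{n+1})=\omega(r_1,\dots,r_{i-1},r_i^{(1)}\rhd r_{i+1},\dots,r_i^{(n+1-i)}\rhd r_{n+1}),$$ $$d_{n+1}^n\omega(r_1,\dots,r_{n+1})=\omega(r_1^{(1)},\dots,r_{n-1}^{(1)},r_n)\rhd\mu^n(r_1^{(2)},\dots,r_{n-1}^{(2)},r_{n+1}).$$ *)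

(* Defs.v *)
From HB Require Import structures.
From mathcomp Require Import all_boot all_order all_algebra.
From mathcomp Require Import boolp zify.
Set Implicit Arguments.
Unset Strict Implicit.
Unset Printing Implicit Defensive.
Import GRing.Theory.
Local Open Scope ring_scope.
Local Open Scope quotient_scope.

Lemma linear_bundle (K : pzRingType) (U V : lmodType K) (f : U -> V) :
  linear f -> exists g : {linear U -> V}, g =1 f.
Proof.
by move=> fl; exists (HB.pack_for {linear U -> V} f (GRing.isLinear.Build K U V *:%R f fl)).
Qed.

Section Tensor.
Variables (K : comNzRingType) (U V : lmodType K).
Implicit Types (s t : seq (U * V)) (x : U) (y : V).

(* The tensor product over K: formal sums of pure tensors, represented by
   sequences of pairs, modulo the bilinearity relations.  Negatives need no
   separate generator, since (- x, y) is inverse to (x, y) by tens_Dl, tens_0. *)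
Inductive tens_rel : seq (U * V) -> seq (U * V) -> Prop :=
| tens_refl s : tens_rel s s
| tens_sym s t : tens_rel s t -> tens_rel t s
| tens_trans s t u : tens_rel s t -> tens_rel t u -> tens_rel s u
| tens_cat s s' t t' :
    tens_rel s s' -> tens_rel t t' -> tens_rel (s ++ t) (s' ++ t')
| tens_catC s t : tens_rel (s ++ t) (t ++ s)
| tens_0 y : tens_rel [:: (0, y)] [::]
| tens_Dl x x' y : tens_rel [:: (x + x', y)] [:: (x, y); (x', y)]
| tens_Dr x y y' : tens_rel [:: (x, y + y')] [:: (x, y); (x, y')]
| tens_Z a x y : tens_rel [:: (a *: x, y)] [:: (x, a *: y)].

Definition tens_relb s t : bool := `[< tens_rel s t >].

Lemma tens_relb_equiv : equiv_class_of tens_relb.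
Proof.
split=> [s|s t|t s u].
- exact/asboolP/tens_refl.
- by apply/asboolP/asboolP; exact: tens_sym.
- by move=> /asboolP st /asboolP tu; apply/asboolP/(tens_trans st tu).
Qed.

Canonical tens_equiv := EquivRelPack tens_relb_equiv.

Definition tens : Type := {eq_quot tens_relb}.
HB.instance Definition _ := Choice.on tens.

Definition tsum s : tens := \pi_({eq_quot tens_relb}) s.

Lemma tsumP s t : tsum s = tsum t <-> tens_rel s t.
Proof.
rewrite /tsum; split=> [/eqP|st]; first by rewrite eqmodE => /asboolP.
by apply/eqP; rewrite eqmodE; apply/asboolP.
Qed.

Definition tscale_seq (a : K) s := [seq (a *: p.1, p.2) | p <- s].

Lemma tens_rel_scale a s t :
  tens_rel s t -> tens_rel (tscale_seq a s) (tscale_seq a t).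
Proof.
rewrite /tscale_seq; elim=> /=.
- by move=> ?; exact: tens_refl.
- by move=> ? ? _; exact: tens_sym.
- by move=> ? ? ? _ h _; exact: tens_trans.
- by move=> ? ? ? ? _ h _ h'; rewrite !map_cat; exact: tens_cat.
- by move=> ? ?; rewrite !map_cat; exact: tens_catC.
- by move=> y; rewrite scaler0; exact: tens_0.
- by move=> x x' y; rewrite scalerDr; exact: tens_Dl.
- by move=> x y y'; exact: tens_Dr.
- by move=> b x y; rewrite scalerA mulrC -scalerA; exact: tens_Z.
Qed.

Definition tadd (z w : tens) := tsum (repr z ++ repr w).
Definition topp (z : tens) := tsum (tscale_seq (- 1) (repr z)).
Definition tscale (a : K) (z : tens) := tsum (tscale_seq a (repr z)).

Lemma tsumK z : tsum (repr z) = z.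
Proof. exact: reprK. Qed.

Lemma tens_indS (P : tens -> Prop) : (forall s, P (tsum s)) -> forall z, P z.
Proof. by move=> h z; rewrite -(tsumK z). Qed.

Lemma repr_tsum s : tens_rel (repr (tsum s)) s.
Proof. by apply/tsumP; rewrite tsumK. Qed.

Lemma taddE s t : tadd (tsum s) (tsum t) = tsum (s ++ t).
Proof. by apply/tsumP/tens_cat; exact: repr_tsum. Qed.

Lemma tscaleE a s : tscale a (tsum s) = tsum (tscale_seq a s).
Proof. exact/tsumP/tens_rel_scale/repr_tsum. Qed.

Lemma taddA : associative tadd.
Proof.
by elim/tens_indS=> r; elim/tens_indS=> s; elim/tens_indS=> t;
  rewrite !taddE catA.
Qed.

Lemma taddC : commutative tadd.
Proof.
by elim/tens_indS=> s; elim/tens_indS=> t; rewrite !taddE; apply/tsumP/tens_catC.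
Qed.

Lemma tadd0 : left_id (tsum [::]) tadd.
Proof. by elim/tens_indS=> s; rewrite taddE. Qed.

Lemma taddN : left_inverse (tsum [::]) topp tadd.
Proof.
elim/tens_indS=> s; rewrite /topp -/(tscale (-1) (tsum s)) tscaleE taddE.
apply/tsumP; elim: s => [|[x y] s IH]; first exact: tens_refl.
have h : tens_rel ([:: (-1 *: x, y)] ++ [:: (x, y)]) [::].
  apply: tens_trans (tens_sym (tens_Dl _ _ _)) _.
  by rewrite scaleN1r addNr; exact: tens_0.
rewrite /= -cat1s -(cat1s (x, y) s).
apply: tens_trans (tens_cat (tens_refl _) _)  _.
  by rewrite catA; apply: tens_cat (tens_catC _ _) (tens_refl _).
by rewrite -catA catA; apply: (tens_cat h IH).
Qed.

HB.instance Definition _ := GRing.isZmodule.Build tens taddA taddC tadd0 taddN.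

Lemma tsum_cat s t : tsum (s ++ t) = tsum s + tsum t.
Proof. by rewrite -taddE. Qed.

Lemma tscaleA a b z : tscale a (tscale b z) = tscale (a * b) z.
Proof.
elim/tens_indS: z => s; rewrite !tscaleE /tscale_seq -map_comp.
by congr tsum; apply: eq_map => p /=; rewrite scalerA.
Qed.

Lemma tscale1 : left_id 1 tscale.
Proof.
elim/tens_indS=> s; rewrite tscaleE; congr tsum.
by rewrite /tscale_seq -[RHS]map_id; apply: eq_map => -[x y]; rewrite scale1r.
Qed.

Lemma tscaleDr : right_distributive tscale +%R.
Proof.
move=> a; elim/tens_indS=> s; elim/tens_indS=> t.
by rewrite -tsum_cat !tscaleE /tscale_seq map_cat tsum_cat.
Qed.

Lemma tscaleDl z : {morph tscale^~ z : a b / a + b}.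
Proof.
elim/tens_indS: z => s a b; rewrite !tscaleE.
elim: s => [|[x y] s IH] /=; first by rewrite -tsum_cat.
have tcons c : tsum (tscale_seq c ((x, y) :: s))
    = tsum [:: (c *: x, y)] + tsum (tscale_seq c s) by rewrite -tsum_cat.
rewrite !tcons IH addrACA; congr (_ + _).
by rewrite -tsum_cat scalerDl; apply/tsumP; exact: tens_Dl.
Qed.

HB.instance Definition _ := GRing.Zmodule_isLmodule.Build K tens
  tscaleA tscale1 tscaleDr tscaleDl.


Lemma scale_tsum a s : a *: tsum s = tsum (tscale_seq a s).
Proof. exact: tscaleE. Qed.

Definition tpure x y : tens := tsum [:: (x, y)].

Lemma tpure_bilinear : bilinear_for *:%R *:%R tpure.
Proof.
split=> [y a x x' | x a y y'].
  rewrite /= /tpure scale_tsum -tsum_cat.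
  by apply/tsumP; rewrite /=; exact: tens_Dl.
rewrite /= /tpure scale_tsum -tsum_cat.
apply/tsumP; apply: tens_trans (tens_Dr _ _ _) _.
apply: (tens_cat (s := [:: _]) (s' := [:: _]) _ (tens_refl _)).
exact/tens_sym/tens_Z.
Qed.

Lemma tsumE s : tsum s = \sum_(p <- s) tpure p.1 p.2.
Proof.
elim: s => [|[x y] s IH]; first by rewrite big_nil.
by rewrite big_cons -IH -tsum_cat.
Qed.

(* tlift f (sum of x_i \ox y_i) is the sum of the f x_i y_i; it is computed on a
   chosen representative, which does not matter when f is bilinear (tlift_sum).
   Sweedler sums are written with it: tlift f (comul a) is the sum of the
   f a^(1) a^(2). *)
Definition tlift (W : lmodType K) (f : U -> V -> W) (z : tens) : W :=
  \sum_(p <- repr z) f p.1 p.2.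

Section Lift.
Variables (W : lmodType K) (f : U -> V -> W).
Hypothesis f_bil : bilinear_for *:%R *:%R f.

Lemma tlift_sum s : tlift f (tsum s) = \sum_(p <- s) f p.1 p.2.
Proof.
have fl y := linear_bundle (f_bil.1 y); have fr x := linear_bundle (f_bil.2 x).
rewrite /tlift; move: (repr _) (repr_tsum s) => r; elim=> {r s} //=.
- by move=> s t u _ -> _ ->.
- by move=> s s' t t' _ h _ h'; rewrite !big_cat /= h h'.
- by move=> s t; rewrite !big_cat /= addrC.
- by move=> y; rewrite big_seq1 big_nil /=; case: (fl y) => g e; rewrite -e linear0.
- move=> x x' y; rewrite !big_cons big_nil /= addr0.
  by case: (fl y) => g e; rewrite -!e linearD addr0.
- move=> x y y'; rewrite !big_cons big_nil /= addr0.
  by case: (fr x) => g e; rewrite -!e linearD addr0.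
- move=> a x y; rewrite !big_seq1 /=.
  case: (fl y) => g e; rewrite -[LHS]e linearZ e.
  by case: (fr x) => h e'; rewrite -!e' linearZ.
Qed.

Lemma tliftE x y : tlift f (tpure x y) = f x y.
Proof. by rewrite tlift_sum big_seq1. Qed.

Lemma tlift_linear : linear (tlift f).
Proof.
move=> a; elim/tens_indS=> s; elim/tens_indS=> t.
rewrite scale_tsum -tsum_cat !tlift_sum big_cat /=.
congr (_ + _); rewrite /tscale_seq big_map scaler_sumr.
apply: eq_bigr => -[x y] _ /=; have [g e] := linear_bundle (f_bil.1 y).
by rewrite -[LHS]e linearZ e.
Qed.

End Lift.

End Tensor.

Arguments tlift {K U V W} f z.
Notation "x \ox y" := (tpure x y) (at level 40, left associativity) : ring_scope.

HB.instance Definition _ (K : comNzRingType) (U V : lmodType K) :=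
  bilinear_isBilinear.Build K U V (tens U V) *:%R *:%R (@tpure K U V)
    (tpure_bilinear U V).

Definition tlin (K : comNzRingType) (U V W : lmodType K) (f : U -> V -> W)
  (f_bil : bilinear_for *:%R *:%R f) : tens U V -> W := tlift f.
Arguments tlin : simpl never.

HB.instance Definition _ (K : comNzRingType) (U V W : lmodType K)
    (f : U -> V -> W) (f_bil : bilinear_for *:%R *:%R f) :=
  GRing.isLinear.Build K (tens U V) W *:%R (tlin f_bil) (tlift_linear f_bil).

Section TensorMaps.
Variable K : comNzRingType.
Implicit Types U V W : lmodType K.

Lemma tpureDl U V (x x' : U) (y : V) : (x + x') \ox y = x \ox y + x' \ox y.
Proof. exact: linearDl. Qed.

Lemma tpureDr U V (x : U) (y y' : V) : x \ox (y + y') = x \ox y + x \ox y'.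
Proof. exact: linearDr. Qed.

Lemma tpureZl U V a (x : U) (y : V) : (a *: x) \ox y = a *: (x \ox y).
Proof. exact: linearZl_LR. Qed.

Lemma tpureZr U V a (x : U) (y : V) : x \ox (a *: y) = a *: (x \ox y).
Proof. exact: linearZr_LR. Qed.

Lemma tens_ind U V (P : tens U V -> Prop) :
    (forall x y, P (x \ox y)) -> (forall z w, P z -> P w -> P (z + w)) ->
  forall z, P z.
Proof.
move=> Pp Pd; elim/tens_indS=> s; rewrite tsumE.
elim: s => [|p s IH]; last by rewrite big_cons; apply: Pd.
by rewrite big_nil -(linear0l (@tpure K U V) 0); exact: Pp.
Qed.

Lemma tlinE U V W (f : U -> V -> W) (f_bil : bilinear_for *:%R *:%R f) x y :
  tlin f_bil (x \ox y) = f x y.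
Proof. exact: tliftE. Qed.

Lemma tmap_bilinear U V U' V' (f : {linear U -> U'}) (g : {linear V -> V'}) :
  bilinear_for *:%R *:%R (fun x y => f x \ox g y).
Proof. by split=> [y a x x'|x a y y']; rewrite linearP ?linearPl ?linearPr. Qed.

Definition tmap U V U' V' (f : {linear U -> U'}) (g : {linear V -> V'}) :
  tens U V -> tens U' V' := tlin (tmap_bilinear f g).

HB.instance Definition _ U V U' V' (f : {linear U -> U'}) (g : {linear V -> V'}) := GRing.Linear.on (tmap f g).

Lemma tmapE U V U' V' (f : {linear U -> U'}) (g : {linear V -> V'}) x y :
  tmap f g (x \ox y) = f x \ox g y.
Proof. exact: tlinE. Qed.

Lemma tswap_bilinear U V : bilinear_for *:%R *:%R (fun (x : U) (y : V) => y \ox x).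
Proof. by split=> [y a x x'|x a y y']; rewrite ?linearPl ?linearPr. Qed.

Definition tswap U V : tens U V -> tens V U := tlin (tswap_bilinear U V).

HB.instance Definition _ U V := GRing.Linear.on (@tswap U V).

Lemma tswapE U V x y : @tswap U V (x \ox y) = y \ox x.
Proof. exact: tlinE. Qed.

Lemma tassocl_bilinear U V W (z : W) :
  bilinear_for *:%R *:%R (fun (x : U) (y : V) => x \ox (y \ox z)).
Proof. by split=> [y a x x'|x a y y']; rewrite ?linearPl ?linearPr. Qed.

Lemma tassoc_bilinear U V W :
  bilinear_for *:%R *:%R
    (fun (u : tens U V) (z : W) => tlin (tassocl_bilinear U V z) u).
Proof.
split=> [z a u u'|u a z z']; first exact: linearP.
elim/tens_ind: u => [x y|u u' IH IH']; first by rewrite !tlinE !linearPr.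
by rewrite !linearD /= ; rewrite IH IH' scalerDr addrACA.
Qed.

Definition tassoc U V W : tens (tens U V) W -> tens U (tens V W) :=
  tlin (tassoc_bilinear U V W).

HB.instance Definition _ U V W := GRing.Linear.on (@tassoc U V W).

Lemma tassocE U V W x y z :
  @tassoc U V W ((x \ox y) \ox z) = x \ox (y \ox z).
Proof. by rewrite /tassoc !tlinE. Qed.

Lemma tmidl_bilinear U V U' V' (x : U) (y : V) :
  bilinear_for *:%R *:%R (fun (x' : U') (y' : V') => (x \ox x') \ox (y \ox y')).
Proof. by split=> [? ? ? ?|? ? ? ?]; rewrite ?(linearPl, linearPr). Qed.

Lemma tmidm_bilinear U V U' V' (w : tens U' V') :
  bilinear_for *:%R *:%R (fun (x : U) (y : V) => tlin (tmidl_bilinear U' V' x y) w).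
Proof.
split=> [y a x x'|x a y y'];
  elim/tens_ind: w => [u v|w w' IH IH']; rewrite ?tlinE ?(linearPl, linearPr) //;
  by rewrite !linearD /= ; rewrite IH IH' scalerDr addrACA.
Qed.

Lemma tmid_bilinear U V U' V' :
  bilinear_for *:%R *:%R (fun (z : tens U V) (w : tens U' V') =>
    tlin (tmidm_bilinear U V w) z).
Proof.
split=> [w a z z'|z a w w']; first exact: linearP.
elim/tens_ind: z => [x y|z z' IH IH']; first by rewrite !tlinE linearP.
by rewrite !linearD /= ; rewrite IH IH' scalerDr addrACA.
Qed.

(* (x \ox y) \ox (x' \ox y') |-> (x \ox x') \ox (y \ox y') *)
Definition tmid U V U' V' :
    {linear tens (tens U V) (tens U' V') -> tens (tens U U') (tens V V')} :=
  tlin (tmid_bilinear U V U' V').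

HB.instance Definition _ U V U' V' := GRing.Linear.on (@tmid U V U' V').

Lemma tmidE U V U' V' x y x' y' :
  @tmid U V U' V' ((x \ox y) \ox (x' \ox y')) = (x \ox x') \ox (y \ox y').
Proof. by rewrite [LHS]tlinE tlinE tlinE. Qed.

Lemma tact_bilinear U V (f : {linear U -> K^o}) :
  bilinear_for *:%R *:%R (fun x (y : V) => (f x : K) *: y).
Proof.
split=> [y a x x'|x a y y']; first by rewrite linearP scalerDl /= scalerA.
by rewrite /= scalerDr !scalerA mulrC.
Qed.

Definition tact U V (f : {linear U -> K^o}) : tens U V -> V :=
  tlin (tact_bilinear V f).

HB.instance Definition _ U V (f : {linear U -> K^o}) := GRing.Linear.on (@tact U V f).

Lemma tactE U V (f : {linear U -> K^o}) x (y : V) :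
  @tact U V f (x \ox y) = (f x : K) *: y.
Proof. exact: tlinE. Qed.

End TensorMaps.
Arguments tswap {K U V}.
Arguments tassoc {K U V W}.
Arguments tmid {K U V U' V'}.
Arguments tact {K U V}.
Arguments tmap : simpl never.
Arguments tswap : simpl never.
Arguments tassoc : simpl never.
Arguments tmid : simpl never.
Arguments tact : simpl never.

Record coalgebra (K : comNzRingType) := Coalgebra {
  carrier :> lmodType K;
  comul : {linear carrier -> tens carrier carrier};
  counit : {linear carrier -> K^o};
  comulA : forall c, tassoc (tmap comul idfun (comul c)) =
                     tmap idfun comul (comul c);
  counitl : forall c, tact counit (comul c) = c;
  counitr : forall c, tact counit (tswap (comul c)) = c
}.
Arguments comul {K C} : rename.
Arguments counit {K C} : rename.

Definition cocommutative (K : comNzRingType) (C : coalgebra K) :=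
  forall c : C, tswap (comul c) = comul c.

Definition coalgebra_morphism (K : comNzRingType) (C D : coalgebra K) (f : {linear C -> D}) :=
  (forall c, comul (f c) = tmap f f (comul c)) /\
  (forall c, counit (f c) = counit c).

Section UnitCoalgebra.
Variable K : comNzRingType.

Definition unit_comul (k : K^o) : tens K^o K^o := k \ox (1 : K^o).

Lemma unit_comul_linear : linear unit_comul.
Proof. by move=> a k l; rewrite /unit_comul linearPl. Qed.

HB.instance Definition _ :=
  GRing.isLinear.Build K K^o (tens K^o K^o) *:%R unit_comul unit_comul_linear.

Lemma unit_comulA k :
  tassoc (tmap unit_comul idfun (unit_comul k)) =
  tmap idfun unit_comul (unit_comul k).
Proof. by rewrite /= !tmapE tassocE. Qed.

Lemma unit_counitl k : @tact K K^o K^o idfun (unit_comul k) = k.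
Proof. by rewrite tactE /=; exact: mulr1. Qed.

Lemma unit_counitr k : @tact K K^o K^o idfun (tswap (unit_comul k)) = k.
Proof. by rewrite tswapE tactE /=; exact: scale1r. Qed.

Definition unit_coalgebra : coalgebra K :=
  Coalgebra unit_comulA unit_counitl unit_counitr.

End UnitCoalgebra.

Section TensorCoalgebra.
Variables (K : comNzRingType) (C D : coalgebra K).

Definition tens_comul : tens C D -> tens (tens C D) (tens C D) :=
  tmid \o tmap (@comul K C) (@comul K D).
HB.instance Definition _ := GRing.Linear.on tens_comul.

Definition tens_counit : tens C D -> K^o :=
  @tact K K^o K^o idfun \o tmap (@counit K C) (@counit K D).
HB.instance Definition _ := GRing.Linear.on tens_counit.

Lemma tens_comulE x y : tens_comul (x \ox y) = tmid (comul x \ox comul y).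
Proof. by rewrite /tens_comul /= tmapE. Qed.

Lemma tens_counitE x y : tens_counit (x \ox y) = (counit x : K) * counit y.
Proof. by rewrite /tens_counit /= tmapE tactE. Qed.

Lemma tens_comulA z :
  tassoc (tmap tens_comul idfun (tens_comul z)) =
  tmap idfun tens_comul (tens_comul z).
Proof.
have L x y : tassoc (tmap tens_comul idfun (tmid (x \ox y))) =
    tmap idfun tmid (tmid (tassoc (tmap (@comul K C) idfun x)
                       \ox tassoc (tmap (@comul K D) idfun y))).
  elim/tens_ind: x => [a b|x x' IH IH']; last first.
    by rewrite !(tpureDl, linearD) /= IH IH'.
  elim/tens_ind: y => [a' b'|x x' IH IH']; last first.
    by rewrite !(tpureDr, linearD) /= IH IH'.
  rewrite tmidE !tmapE /= !tens_comulE.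
  move: (comul a) (comul a') => u v.
  elim/tens_ind: u => [c d|x x' IH IH']; last first.
    by rewrite !(tpureDl, linearD) /= ?(tpureDl, linearD) /= IH IH'.
  elim/tens_ind: v => [c' d'|x x' IH IH']; last first.
    by rewrite !(tpureDr, tpureDl, linearD) /= ?(tpureDr, tpureDl, linearD) /= IH IH'.
  by rewrite !(tmidE, tassocE) !tmapE /= tmidE.
have R x y : tmap idfun tens_comul (tmid (x \ox y)) =
    tmap idfun tmid (tmid (tmap idfun (@comul K C) x
                       \ox tmap idfun (@comul K D) y)).
  elim/tens_ind: x => [a b|x x' IH IH']; last first.
    by rewrite !(tpureDl, linearD) /= IH IH'.
  elim/tens_ind: y => [a' b'|x x' IH IH']; last first.
    by rewrite !(tpureDr, linearD) /= IH IH'.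
  by rewrite !(tmidE, tmapE) /= tens_comulE.
elim/tens_ind: z => [x y|z w IH IH']; last by rewrite !linearD /= IH IH'.
by rewrite tens_comulE L R !comulA.
Qed.

Lemma tens_counitl z : tact tens_counit (tens_comul z) = z.
Proof.
have L x y : tact tens_counit (tmid (x \ox y)) =
    tact (@counit K C) x \ox tact (@counit K D) y.
  elim/tens_ind: x => [a b|x x' IH IH']; last first.
    by rewrite !(tpureDl, linearD) /= IH IH'.
  elim/tens_ind: y => [a' b'|x x' IH IH']; last first.
    by rewrite !(tpureDr, linearD) /= IH IH'.
  rewrite tmidE !tactE /= tens_counitE.
  by rewrite tpureZl tpureZr scalerA.
elim/tens_ind: z => [x y|z w IH IH']; last by rewrite !linearD /= IH IH'.
by rewrite tens_comulE L !counitl.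
Qed.

Lemma tens_counitr z : tact tens_counit (tswap (tens_comul z)) = z.
Proof.
have L x y : tact tens_counit (tswap (tmid (x \ox y))) =
    tact (@counit K C) (tswap x) \ox tact (@counit K D) (tswap y).
  elim/tens_ind: x => [a b|x x' IH IH']; last first.
    by rewrite !(tpureDl, linearD) /= IH IH'.
  elim/tens_ind: y => [a' b'|x x' IH IH']; last first.
    by rewrite !(tpureDr, linearD) /= IH IH'.
  rewrite tmidE !tswapE !tactE /= tens_counitE.
  by rewrite tpureZl tpureZr scalerA.
elim/tens_ind: z => [x y|z w IH IH']; last by rewrite !linearD /= IH IH'.
by rewrite tens_comulE L !counitr.
Qed.

Definition tens_coalgebra : coalgebra K :=
  Coalgebra tens_comulA tens_counitl tens_counitr.

End TensorCoalgebra.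

Record rack_bialgebra (K : comNzRingType) := RackBialgebra {
  rack_coalgebra :> coalgebra K;
  rack_one : rack_coalgebra;
  rack_mul : {linear tens_coalgebra rack_coalgebra rack_coalgebra ->
                     rack_coalgebra};
  rack_one_comul : comul rack_one = rack_one \ox rack_one;
  rack_one_counit : counit rack_one = 1;
  rack_mul_morphism : coalgebra_morphism rack_mul;
  rack_mul_one_one : rack_mul (rack_one \ox rack_one) = rack_one;
  rack_one_mul : forall a, rack_mul (rack_one \ox a) = a;
  rack_mul_one : forall a, rack_mul (a \ox rack_one) = (counit a : K) *: rack_one;
  rack_selfdistr : forall a b c,
    rack_mul (a \ox rack_mul (b \ox c)) =
    tlift (fun a1 a2 => rack_mul (rack_mul (a1 \ox b) \ox rack_mul (a2 \ox c)))
          (comul a)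
}.

Definition coder (K : comNzRingType) (C D : coalgebra K)
    (phi f : {linear C -> D}) : Prop :=
  forall c, comul (f c) = tmap f phi (comul c) + tmap phi f (comul c).

Section TensorPower.
Variables (K : comNzRingType) (C : coalgebra K) (V : lmodType K).

(* C^{(x) n}, bracketed to the right; it is C itself for n = 1 and K for n = 0. *)
Fixpoint tpow (n : nat) : coalgebra K :=
  match n with
  | 0 => unit_coalgebra K
  | 1 => C
  | m.+1 => tens_coalgebra C (tpow m)
  end.

(* s_0 \ox ... \ox s_(n-1); meant for sequences s of size n. *)
Fixpoint ptens (n : nat) (s : seq C) : tpow n :=
  match n return tpow n with
  | 0 => (1 : K^o)
  | m.+1 =>
    match m return tpow m -> tpow m.+1 with
    | 0 => fun=> head 0 s
    | _ => fun z => head 0 s \ox z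
    end (ptens m (behead s))
  end.

(* The linear map sending ptens n s to F s, for F multilinear (tpow_liftE). *)
Fixpoint tpow_lift (n : nat) (F : seq C -> V) : tpow n -> V :=
  match n return tpow n -> V with
  | 0 => fun k => (k : K) *: F [::]
  | m.+1 =>
    match m return ((seq C -> V) -> tpow m -> V) -> tpow m.+1 -> V with
    | 0 => fun _ x => F [:: x]
    | _ => fun lift_m =>
             tlift (fun a => lift_m (fun s => F (a :: s)))
    end (@tpow_lift m)
  end.

(* For s = [:: a_1; ...; a_m], the sum of the
   F [:: a_1^(1); ...; a_m^(1)] [:: a_1^(2); ...; a_m^(2)]. *)
Fixpoint sweedler2 (s : seq C) (F : seq C -> seq C -> V) : V :=
  if s is a :: s' then
    tlift (fun a1 a2 => sweedler2 s' (fun s1 s2 => F (a1 :: s1) (a2 :: s2)))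
          (comul a)
  else F [::] [::].

(* The sum of the F [:: a^(1); ...; a^(n)]. *)
Fixpoint sweedler (n : nat) (a : C) (F : seq C -> V) : V :=
  match n with
  | 0 => (counit a : K) *: F [::]
  | 1 => F [:: a]
  | m.+1 => tlift (fun a1 a2 => sweedler m a2 (fun s => F (a1 :: s))) (comul a)
  end.

(* F is only considered on sequences of size n. *)
Definition multilinear (n : nat) (F : seq C -> V) : Prop :=
  forall s t, (size s + size t).+1 = n -> linear (fun a => F (s ++ a :: t)).

End TensorPower.

Section DeformationComplex.
Variables (K : comNzRingType) (R : rack_bialgebra K).

Definition rhd (a b : R) : R := rack_mul R (a \ox b).

(* The map mu^n; only n >= 1 is meaningful, the value for n = 0 is arbitrary. *)
Fixpoint rack_pow (n : nat) : {linear tpow R n -> R} :=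
  match n return {linear tpow R n -> R} with
  | 0 => \0
  | m.+1 =>
    match m return {linear tpow R m -> R} -> {linear tpow R m.+1 -> R} with
    | 0 => fun=> idfun
    | _ => fun mu_m => rack_mul R \o tmap idfun mu_m
    end (rack_pow m)
  end.

(* In the formulas below r = [:: r_1; ...; r_(n+1)] and entry r i is r_i, so that
   take i.-1 r lists r_1, ..., r_(i-1) and drop i r lists r_(i+1), ..., r_(n+1). *)
Definition entry (r : seq R) (i : nat) : R := nth 0 r i.-1.

Section Coboundary.
Variables (n : nat) (w : {linear tpow R n -> R}).

Definition cobound1 (i : nat) (r : seq R) : R :=
  sweedler2 (take i.-1 r) (fun s1 s2 =>
    rhd (rack_pow i (ptens i (rcons s1 (entry r i))))
        (w (ptens n (s2 ++ drop i r)))).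

Definition cobound0 (i : nat) (r : seq R) : R :=
  sweedler (n.+1 - i) (entry r i) (fun a =>
    w (ptens n (take i.-1 r ++ [seq rhd p.1 p.2 | p <- zip a (drop i r)]))).

Definition cobound_last (r : seq R) : R :=
  sweedler2 (take n.-1 r) (fun s1 s2 =>
    rhd (w (ptens n (rcons s1 (entry r n))))
        (rack_pow n (ptens n (rcons s2 (entry r n.+1))))).

Definition cobound_form (r : seq R) : R :=
  \sum_(1 <= i < n.+1) (-1) ^+ i.+1 *: (cobound1 i r - cobound0 i r)
  + (-1) ^+ n.+1 *: cobound_last r.

End Coboundary.
End DeformationComplex.

Section Multilinear.
Variables (K : comNzRingType) (C : coalgebra K).

Lemma ptensSS n s : ptens n.+2 s = head 0 s \ox ptens n.+1 (behead s) :> tpow C n.+2.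
Proof. by []. Qed.

Section Lift.
Variable V : lmodType K.
Implicit Type F : seq C -> V.

Lemma tpow_liftSS n F (z : tpow C n.+2) :
  tpow_lift F z =
  tlift (fun a => @tpow_lift K C V n.+1 (fun s => F (a :: s))) z.
Proof. by []. Qed.

Lemma sweedlerSS n a F :
  sweedler n.+2 a F =
  tlift (fun a1 a2 => sweedler n.+1 a2 (fun s => F (a1 :: s))) (comul a).
Proof. by []. Qed.

Lemma multilinear_behead n F a :
  multilinear n.+1 F -> multilinear n (fun s => F (a :: s)).
Proof. by move=> Fm s t st; apply: (Fm (a :: s) t); rewrite /= -st. Qed.

Lemma tpow_lift_affine n k F G H (z : tpow C n) :
    (forall s, size s = n -> H s = k *: F s + G s) ->
  tpow_lift H z = k *: tpow_lift F z + tpow_lift G z.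
Proof.
elim: n F G H z => [|[|n] IH] F G H z HE.
- by rewrite /= HE // scalerDr !scalerA mulrC.
- by rewrite /= HE.
- rewrite !tpow_liftSS /tlift scaler_sumr -big_split; apply: eq_bigr => p _.
  by apply: IH => s sn; apply: HE; rewrite /= sn.
Qed.

Lemma tpow_lift_bilinear n F : multilinear n.+2 F ->
  (forall m G, m = n.+1 -> multilinear m G -> linear (@tpow_lift _ C V m G)) ->
  bilinear_for *:%R *:%R
    (fun a => @tpow_lift _ C V n.+1 (fun s => F (a :: s))).
Proof.
move=> Fm IH; split=> [z a x x'|x]; last by apply: IH => //; exact: multilinear_behead.
by apply: tpow_lift_affine => s sn; apply: (Fm [::] s); rewrite /= sn.
Qed.

Lemma tpow_lift_linear n F : multilinear n F -> linear (@tpow_lift _ C V n F).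
Proof.
elim: n F => [|[|n] IH] F Fm.
- by move=> a k l; rewrite /= scalerDl scalerA.
- by move=> a x y; apply: (Fm [::] [::]).
- by apply/tlift_linear/tpow_lift_bilinear => // m G ->; exact: IH.
Qed.

Lemma tpow_liftE n F s :
  multilinear n F -> size s = n -> tpow_lift F (ptens n s) = F s.
Proof.
elim: n F s => [|[|n] IH] F s Fm sn.
- by case: s sn => //= _; rewrite scale1r.
- by case: s sn => [|a []].
- case: s sn => [|a s] // [sn]; rewrite tpow_liftSS ptensSS tliftE.
    by rewrite IH //; exact: multilinear_behead.
  by apply: tpow_lift_bilinear => // m G _; exact: tpow_lift_linear.
Qed.

Lemma sweedler2_affine k (G G' G'' : seq C -> seq C -> V) r :
    (forall s t, size s = size r -> size t = size r ->
       G s t = k *: G' s t + G'' s t) ->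
  sweedler2 r G = k *: sweedler2 r G' + sweedler2 r G''.
Proof.
elim: r G G' G'' => [|a r IH] G G' G'' GE /=; first exact: GE.
rewrite /tlift scaler_sumr -big_split; apply: eq_bigr => p _ /=.
by apply: IH => s t sr tr; apply: GE; rewrite /= ?sr ?tr.
Qed.

Lemma sweedler_affine k n (G G' G'' : seq C -> V) a :
    (forall s, size s = n -> G s = k *: G' s + G'' s) ->
  sweedler n a G = k *: sweedler n a G' + sweedler n a G''.
Proof.
elim: n a G G' G'' => [|[|n] IH] a G G' G'' GE.
- by rewrite /= GE // scalerDr !scalerA mulrC.
- by rewrite /= GE.
rewrite !sweedlerSS /tlift scaler_sumr -big_split; apply: eq_bigr => p _.
by apply: IH => s sn; apply: GE; rewrite /= sn.
Qed.

Lemma sweedler_linear n F : multilinear n F -> linear (fun a => sweedler n a F).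
Proof.
elim: n F => [|[|n] IH] F Fm.
- by move=> a x y; rewrite /= linearP scalerDl scalerA.
- exact: (Fm [::] [::]).
move=> a x y; rewrite !sweedlerSS linearP tlift_linear //.
split=> [z b u u'|u].
  by apply: sweedler_affine => s sn; apply: (Fm [::] s); rewrite /= sn.
exact/IH/multilinear_behead.
Qed.

Lemma sweedler2_multilinear i m (G : seq C -> seq C -> seq C -> V) :
    (forall s t, size s = i -> size t = i -> multilinear m (G s t)) ->
    (forall s u, size s = i -> size u = m -> multilinear i (G s ^~ u)) ->
    (forall t u, size t = i -> size u = m -> multilinear i (fun s => G s t u)) ->
  multilinear (i + m) (fun r =>
    sweedler2 (take i r) (fun s t => G s t (drop i r))).
Proof.
elim: i G => [|i IH] G G3 G2 G1.
  move=> s t st a x y; rewrite !take0 !drop0 /=.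
  exact: (G3 [::] [::]).
move=> [|a s] t st; last first.
  move=> k x y /=; rewrite /tlift scaler_sumr -big_split.
  apply: eq_bigr => -[a1 a2] _ /=.
  apply: (IH (fun s1 s2 => G (a1 :: s1) (a2 :: s2))); last by case: st.
  - by move=> s1 t1 e1 e2; apply: G3; rewrite /= ?e1 ?e2.
  - by move=> s1 u e1 e2 s2 t2 e; apply: (G2 _ _ _ _ (a2 :: s2)); rewrite /= ?addSn ?e ?e1 ?e2.
  - by move=> t1 u e1 e2 s2 t2 e; apply: (G1 _ _ _ _ (a1 :: s2)); rewrite /= ?addSn ?e ?e1 ?e2.
case: st; rewrite add0n => st.
have sz : size (take i t) = i by rewrite size_take_min st; apply/minn_idPl/leq_addr.
have sd : size (drop i t) = m by rewrite size_drop st addKn.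
move=> k x y /=; rewrite linearP tlift_linear //; split=> [a2 b u v|a1 b u v].
  apply: sweedler2_affine => s1 t1; rewrite sz => s1i t1i.
  by apply: (G1 _ _ _ _ [::] s1); rewrite /= ?s1i ?t1i.
apply: sweedler2_affine => s1 t1; rewrite sz => s1i t1i.
by apply: (G2 _ _ _ _ [::] t1); rewrite /= ?s1i ?t1i.
Qed.

End Lift.

Lemma ptens_multilinear n : multilinear n (@ptens K C n).
Proof.
elim: n => [|[|n] IH] s t // [st].
  by case: s t st => [|? ?] [|? ?].
case: s st => [|b s] st a x y; rewrite !ptensSS; first by rewrite /= tpureDl tpureZl.
by rewrite -tpureZr -tpureDr (IH s t).
Qed.

End Multilinear.

Arguments ptens : simpl never.
Arguments rack_pow : simpl never.
Arguments sweedler : simpl never.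

Section CoboundaryForm.
Variables (K : comNzRingType) (R : rack_bialgebra K).

Lemma rhd_linearl (f : R -> R) c : linear f -> linear (fun a => rhd (f a) c).
Proof. by move=> fl a x y; rewrite /rhd fl tpureDl tpureZl linearP. Qed.

Lemma rhd_linearr (f : R -> R) c : linear f -> linear (fun a => rhd c (f a)).
Proof. by move=> fl a x y; rewrite /rhd fl tpureDr tpureZr linearP. Qed.

Lemma rhd0r (a : R) : rhd a 0 = 0.
Proof. by rewrite /rhd -[X in tpure _ X](scale0r (0 : R)) tpureZr scale0r linear0. Qed.

Lemma linear_ptens n (w : {linear tpow R n -> R}) (s t : seq R) :
  (size s + size t).+1 = n -> linear (fun a => w (ptens n (s ++ a :: t))).
Proof. by move=> st a x y; rewrite (ptens_multilinear st) linearP. Qed.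

Lemma linear_ptens_rcons n (w : {linear tpow R n -> R}) (s : seq R) :
  (size s).+1 = n -> linear (fun a => w (ptens n (rcons s a))).
Proof.
by move=> st a x y; rewrite -!cats1 linear_ptens ?cats1 // addn0.
Qed.

Lemma eq_multilinear (V : lmodType K) n (F G : seq R -> V) :
  F =1 G -> multilinear n F -> multilinear n G.
Proof. by move=> FG Fm s t st a x y; rewrite -!FG; exact: Fm. Qed.

Section Form.
Variables (n : nat) (w : {linear tpow R n -> R}).

Lemma cobound1_multilinear i : (0 < i <= n)%N -> multilinear n.+1 (cobound1 w i).
Proof.
case: i => // i; rewrite /= => lt_in.
pose G (s1 s2 u : seq R) := rhd (rack_pow R i.+1 (ptens i.+1 (rcons s1 (head 0 u))))
  (w (ptens n (s2 ++ behead u))).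
have -> : n.+1 = (i + (n - i).+1)%N by rewrite addnS subnKC // ltnW.
have e r : sweedler2 (take i r) (fun s1 s2 => G s1 s2 (drop i r)) = cobound1 w i.+1 r.
  by rewrite /cobound1 /G /entry /= -nth0 nth_drop addn0 -drop1 drop_drop.
apply: (eq_multilinear e); apply: sweedler2_multilinear.
- move=> s1 s2 e1 e2 [|b s] t [st]; rewrite /G /=.
    by apply: rhd_linearl; apply: linear_ptens_rcons; rewrite e1.
  apply: rhd_linearr => a x y; rewrite !catA; apply: linear_ptens.
  have ar p q : (p.+1 + q = n - i -> (i + p + q).+1 = n)%N by lia.
  by rewrite size_cat e2; apply: ar.
- move=> s1 u e1 um s t st; rewrite /G; apply: rhd_linearr => a x y; rewrite -!catA !cat_cons.
  apply: linear_ptens; rewrite size_cat size_behead um /=.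
  have ar p q : (p + q).+1 = i -> (p + (q + (n - i))).+1 = n by lia.
  exact: ar.
- move=> s1 u e1 um s t st; rewrite /G; apply: rhd_linearl => a x y; rewrite !rcons_cat !rcons_cons.
  by apply: linear_ptens; rewrite size_rcons addnS; congr _.+1.
Qed.

Lemma cobound_last_multilinear : multilinear n.+1 (cobound_last w).
Proof.
have [n0|n_gt0] := posnP n.
  have e r : cobound_last w r = 0.
    rewrite /cobound_last; case: n n0 w => // ? w' /=.
    by rewrite take0 /= rhd0r.
  by move=> s t _ a x y; rewrite !e scaler0 addr0.
pose G (s1 s2 u : seq R) := rhd (w (ptens n (rcons s1 (head 0 u))))
  (rack_pow R n (ptens n (rcons s2 (nth 0 u 1)))).
have -> : n.+1 = (n.-1 + 2)%N by rewrite addn2 prednK.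
have e r : sweedler2 (take n.-1 r) (fun s1 s2 => G s1 s2 (drop n.-1 r)) = cobound_last w r.
  by rewrite /cobound_last /G /entry /= -nth0 !nth_drop addn0 addn1 prednK.
apply: (eq_multilinear e); apply: sweedler2_multilinear.
- move=> s1 s2 e1 e2 [|b [|b' s]] [|c t] // st; rewrite /G /=.
    by apply: rhd_linearl; apply: linear_ptens_rcons; rewrite e1 prednK.
  by apply: rhd_linearr; apply: linear_ptens_rcons; rewrite e2 prednK.
- move=> s1 u e1 um s t st; rewrite /G; apply: rhd_linearr => a x y; rewrite !rcons_cat !rcons_cons.
  by apply: linear_ptens; rewrite size_rcons addnS; exact: etrans (congr1 succn st) (prednK n_gt0).
- move=> s1 u e1 um s t st; rewrite /G; apply: rhd_linearl => a x y; rewrite !rcons_cat !rcons_cons.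
  by apply: linear_ptens; rewrite size_rcons addnS; exact: etrans (congr1 succn st) (prednK n_gt0).
Qed.

Lemma cobound0_multilinear i : (0 < i <= n)%N -> multilinear n.+1 (cobound0 w i).
Proof.
case: i => // i /= lt_in.
pose act (a u : seq R) := [seq rhd p.1 p.2 | p <- zip a u].
have size_act a u : size a = size u -> size (act a u) = size u.
  by move=> au; rewrite size_map size_zip au minnn.
have act_cat a1 b a2 u1 c u2 : size a1 = size u1 ->
    act (a1 ++ b :: a2) (u1 ++ c :: u2) = act a1 u1 ++ rhd b c :: act a2 u2.
  by move=> au; rewrite /act zip_cat // map_cat.
have split_at (u : seq R) k : (k < size u)%N ->
    u = take k u ++ nth 0 u k :: drop k.+1 u.
  by move=> ku; rewrite -drop_nth // cat_take_drop.
pose F (v : seq R) := sweedler (n - i) (nth 0 v i) (fun a =>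
  w (ptens n (take i v ++ act a (drop i.+1 v)))).
apply: (@eq_multilinear _ _ F) => [v|]; first by rewrite /F /cobound0 subSS.
move=> s t [st] k x y.
have [lt_si|lt_is|e_si] := ltngtP (size s) i.
- have [j ij] : {j | i = (size s + j.+1)%N}.
    by exists (i - size s).-1; rewrite prednK ?subn_gt0 // subnKC // ltnW.
  have E z : F (s ++ z :: t) = sweedler (n - i) (nth 0 t j) (fun a =>
      w (ptens n (s ++ z :: (take j t ++ act a (drop j.+1 t))))).
    have e1 : take i (s ++ z :: t) = s ++ z :: take j t.
      by rewrite ij take_cat ltnNge leq_addr addKn.
    have e2 : drop i.+1 (s ++ z :: t) = drop j.+1 t.
      by rewrite ij -addnS drop_cat ltnNge leq_addr addKn.
    have e3 : nth 0 (s ++ z :: t) i = nth 0 t j.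
      by rewrite ij nth_cat ltnNge leq_addr addKn.
    by rewrite /F e1 e2 e3; congr sweedler; apply/funext => a; rewrite -catA.
  have lt_jt : (j < size t)%N by move: lt_in; rewrite ij -st ltn_add2l; exact: ltnW.
  rewrite !E; apply: sweedler_affine => a sa; apply: linear_ptens.
  rewrite size_cat size_takel ?(ltnW lt_jt) // size_act ?size_drop; last first.
    by rewrite sa -st ij subnDl.
  by rewrite -addnS -addnS -subSn // subSS subnKC // ltnW.
- have [j ij] : {j | size s = (i + j.+1)%N}.
    by exists (size s - i).-1; rewrite prednK ?subn_gt0 // subnKC // ltnW.
  have E z : F (s ++ z :: t) = sweedler (n - i) (nth 0 s i) (fun a =>
      w (ptens n (take i s ++ act a (drop i.+1 s ++ z :: t)))).
    have e1 : take i (s ++ z :: t) = take i s by rewrite take_cat lt_is.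
    have e2 : drop i.+1 (s ++ z :: t) = drop i.+1 s ++ z :: t.
      rewrite drop_cat; case: ifP => // /negbT; rewrite -leqNgt => le_si.
      have es : size s = i.+1 by apply/eqP; rewrite eqn_leq le_si lt_is.
      by rewrite es subnn drop0 drop_oversize // es.
    have e3 : nth 0 (s ++ z :: t) i = nth 0 s i by rewrite nth_cat lt_is.
    by rewrite /F e1 e2 e3.
  have sd : size (drop i.+1 s) = j by rewrite size_drop ij -addSnnS addKn.
  rewrite !E; apply: sweedler_affine => a sa.
  have lt_ja : (j < size a)%N.
    by rewrite sa -st ij -addnA addKn addSn ltnS leq_addr.
  rewrite (split_at a j lt_ja) !act_cat ?sd ?size_takel ?(ltnW lt_ja) // !catA.
  set l := _ ++ act _ _; set l' := act _ t.
  pose lw := @rhd_linearr idfun (nth 0 a j) (fun a x y => erefl).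
  rewrite (lw k x y); apply: linear_ptens.
  rewrite size_cat !size_act ?sd ?size_takel ?(ltnW lt_ja) ?(ltnW lt_is) //.
    by rewrite -addSn -addnS -ij.
  by rewrite size_drop sa -st ij -addnA addKn addSn subSS addKn.
- have E z : F (s ++ z :: t) = sweedler (n - i) z (fun a =>
      w (ptens n (s ++ act a t))).
    have e1 : take i (s ++ z :: t) = s by rewrite take_size_cat.
    have e2 : drop i.+1 (s ++ z :: t) = t.
      by rewrite -e_si drop_cat ltnNge leqnSn /= subSnn /= drop0.
    have e3 : nth 0 (s ++ z :: t) i = z by rewrite nth_cat e_si ltnn subnn.
    by rewrite /F e1 e2 e3.
  rewrite !E; apply: sweedler_linear => a1 a2 sa.
  have lt_t : (size a1 < size t)%N.
    by rewrite -(ltn_add2l (size s)) st e_si -ltn_subRL -sa ltnS leq_addr.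
  move=> {}k {}x {}y; rewrite (split_at t _ lt_t) !act_cat ?size_takel ?(ltnW lt_t) //.
  pose lw := @rhd_linearl idfun (nth 0 t (size a1)) (fun a x y => erefl).
  rewrite (lw k x y) !catA; apply: linear_ptens.
  rewrite size_cat !size_act ?size_takel ?(ltnW lt_t) //.
    by rewrite size_drop -addnS -subSn // subSS -addnA subnKC // ltnW.
  apply/eqP; rewrite size_drop -(eqn_add2l (size a1).+1) subnKC // addSn sa.
  by rewrite -st e_si addKn.
Qed.

Lemma cobound_form_multilinear : multilinear n.+1 (cobound_form w).
Proof.
move=> s t st k x y; rewrite /cobound_form (cobound_last_multilinear st).
rewrite [X in X + _ = _](_ : _ =
    k *: (\sum_(1 <= i < n.+1) (-1) ^+ i.+1 *:
            (cobound1 w i (s ++ x :: t) - cobound0 w i (s ++ x :: t)))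
    + \sum_(1 <= i < n.+1) (-1) ^+ i.+1 *:
            (cobound1 w i (s ++ y :: t) - cobound0 w i (s ++ y :: t))).
  rewrite !(scalerDr k) (scalerDr ((-1) ^+ n.+1)) !scalerA [k * _]mulrC.
  by rewrite -!addrA; congr (_ + _); rewrite addrCA.
rewrite scaler_sumr -big_split; apply: eq_big_nat => i i_n /=.
rewrite (cobound1_multilinear i_n st) (cobound0_multilinear i_n st).
by rewrite opprD addrACA scalerDr -scalerBr !scalerA mulrC.
Qed.

(* By multilinearity of the defining formula, this is the linear map whose value
   on a pure tensor is given by that formula (coboundaryE). *)
Definition coboundary : tpow R n.+1 -> R := tpow_lift (cobound_form w).

HB.instance Definition _ :=
  GRing.isLinear.Build K (tpow R n.+1) R *:%R coboundary
    (tpow_lift_linear cobound_form_multilinear).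

Lemma coboundaryE r :
  size r = n.+1 -> coboundary (ptens n.+1 r) = cobound_form w r.
Proof. exact: (tpow_liftE cobound_form_multilinear). Qed.

End Form.
End CoboundaryForm.

(* Main.v *)
(* For a cocommutative coalgebra T, convolution x |> y := mu (x (x) y) Delta is a
   bilinear operation on Hom(T, R) which is self-distributive on the left factors
   that are coalgebra morphisms: these behave like the elements of a set-theoretic
   rack.  A coderivation is a tangent vector v to such a morphism m, in the sense
   that Delta v = (v (x) m + m (x) v) Delta, and acts by the Leibniz rule
   v |> (y |> z) = (v |> y) |> (m |> z) + (m |> y) |> (v |> z).
   Evaluating cochains on tuples of morphisms T -> R turns the Sweedler formula of
   the coboundary into that of rack cohomology, which we prove to be a
   differential by induction, splitting off the first argument; taking T to be a
   tensor power of R and the tuple of its projections gives back the statement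
   about linear maps. *)

From HB Require Import structures.
Require Import Defs.
From mathcomp Require Import all_boot all_order all_algebra.
From mathcomp Require Import boolp zify.
Set Implicit Arguments.
Unset Strict Implicit.
Unset Printing Implicit Defensive.
Import GRing.Theory.
Local Open Scope ring_scope.

(** * Rack cohomology for a biadditive operation, self-distributive on a subset *)

Section SelfDistributive.
Variables (K : pzRingType) (H : lmodType K) (op : H -> H -> H) (M : pred H).
Implicit Types (x y z : H) (s u : seq H) (P : H -> H) (w : seq H -> H).

(** The counterpart of mu^n on lists; the value on the empty list is arbitrary. *)
Fixpoint opr s : H :=
  if s is x :: s' then if s' is [::] then x else op x (opr s') else 0.

(* Rack coboundary of w, with P the left multiplication by the arguments already
   split off: the terms for the first argument x are explicit, the others form the
   coboundary, of one degree less and opposite sign, of w(x, -).  It is meant for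
   lists of size at least 2. *)
Fixpoint cob P w s : H :=
  if s isn't x :: s' then 0 else
  if s' is [:: y] then op (P x) (w [:: y]) - w [:: op x y] + op (w [:: x]) (P y)
  else op (P x) (w s') - w (map (op x) s')
       - cob (P \o op x) (fun u => w (x :: u)) s'.

Lemma opr_cons x s : s != [::] -> opr (x :: s) = op x (opr s).
Proof. by case: s. Qed.

Lemma cob2 P w x y :
  cob P w [:: x; y] = op (P x) (w [:: y]) - w [:: op x y] + op (w [:: x]) (P y).
Proof. by []. Qed.

Lemma cob_cons P w x y z s : let s' := [:: y, z & s] in
  cob P w (x :: s') = op (P x) (w s') - w (map (op x) s')
    - cob (P \o op x) (fun u => w (x :: u)) s'.
Proof. by []. Qed.

Lemma cobE n P w s : size s = n.+2 ->
  cob P w s =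
  \sum_(1 <= i < n.+2) (-1) ^+ i.+1 *:
     (op (P (opr (take i s))) (w (take i.-1 s ++ drop i s))
      - w (take i.-1 s ++ map (op (nth 0 s i.-1)) (drop i s)))
  + (-1) ^+ n.+2 *: op (w (take n.+1 s)) (P (opr (take n s ++ drop n.+1 s))).
Proof.
elim: n P w s => [|n IH] P w s.
  case: s => [|x [|y []]] // _.
  by rewrite big_nat1 sqrrN expr1n !scale1r.
case: s => [|x [|y [|z s]]] // [sz]; rewrite cob_cons.
have {sz} : size [:: y, z & s] = n.+2 by rewrite /= sz.
move: [:: y, z & s] => s1 s1n; rewrite {}IH // [in RHS]big_nat_recl //.
rewrite sqrrN expr1n scale1r /= take0 drop0 -[RHS]addrA; congr (_ + _).
have signS k (v : H) : - ((-1) ^+ k *: v) = (-1) ^+ k.+1 *: v.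
  by rewrite -scaleNr exprS mulN1r.
rewrite opprD -sumrN signS; congr (_ + _).
  apply: eq_big_nat => -[|i] // /andP[_ i_n].
  rewrite signS /=; congr (_ *: (op (P _) _ - _)); rewrite [RHS]opr_cons //.
  by rewrite -size_eq0 size_takel ?s1n //; exact: ltnW.
congr (_ *: _); congr (op _ (P _)); rewrite [RHS]opr_cons // -size_eq0 size_cat.
by rewrite size_takel ?size_drop s1n; lia.
Qed.

Lemma eq_cob P P' w w' s : P =1 P' -> all M s ->
    (forall u, all M u -> size u = (size s).-1 -> w u = w' u) ->
    (forall x y, M x -> M y -> M (op x y)) ->
  cob P w s = cob P' w' s.
Proof.
move=> + + + M_op.
elim: s P P' w w' => [|x [|y [|z s]] IH] P P' w w' // PP' Ms ww'.
- by move: Ms => /= Ms; rewrite /= PP' !ww'.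
- case/and3P: Ms => Mx My _; rewrite !cob2 !PP' !ww' //= ?Mx ?My ?M_op //.
have /andP[Mx Ms'] : M x && all M [:: y, z & s] := Ms.
rewrite !cob_cons PP' !ww' ?size_map //; last first.
  by rewrite all_map; apply/allP => v /(allP Ms') Mv /=; exact: M_op.
congr (_ - _); apply: IH => // [v /=|u Mu su]; first by rewrite PP'.
by apply: ww'; rewrite /= ?su ?Mx.
Qed.

Hypothesis opBl : forall x y z, op (x - y) z = op x z - op y z.
Hypothesis opBr : forall x y z, op x (y - z) = op x y - op x z.
Hypothesis M_op : forall x y, M x -> M y -> M (op x y).
Hypothesis opD : forall x y z, M x -> op x (op y z) = op (op x y) (op x z).

Lemma opDl x y z : op (x + y) z = op x z + op y z.
Proof. by apply/eqP; rewrite -subr_eq -opBl addrK. Qed.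
Lemma opDr x y z : op x (y + z) = op x y + op x z.
Proof. by apply/eqP; rewrite -subr_eq -opBr addrK. Qed.

(** The admissible prefixes [P]: the identity is one, and by [op_endo_op] splitting off one more
    argument from [M] gives another. *)
Definition op_endo P := (forall y z, P (op y z) = op (P y) (P z))
  /\ (forall x, M x -> M (P x)).

Lemma op_endo_op P x : op_endo P -> M x -> op_endo (P \o op x).
Proof.
case=> Pop PM Mx; split=> [y z|y My] /=; first by rewrite opD // Pop.
exact/PM/M_op.
Qed.

Lemma all_op x s : M x -> all M s -> all M (map (op x) s).
Proof.
by move=> Mx Ms; rewrite all_map; apply/allP => v /(allP Ms) Mv /=; exact: M_op.
Qed.

Lemma opr_map x s : M x -> s != [::] -> opr (map (op x) s) = op x (opr s).
Proof.
move=> Mx; elim: s => // y [//|z s] IH _.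
by rewrite (@opr_cons y) // opD // -IH.
Qed.

Lemma subACA (V : zmodType) (a b c d : V) : a - b - (c - d) = a - c - (b - d).
Proof. by rewrite !opprD !opprK addrACA. Qed.

Lemma cobB P w w' s :
  cob P (fun u => w u - w' u) s = cob P w s - cob P w' s.
Proof.
elim: s P w w' => [|x [|y [|z s]] IH] P w w'; first by rewrite /= subr0.
- by rewrite /= opBr !subr0 subACA.
- by rewrite !cob2 opBr opBl subACA addrACA -opprD.
by rewrite !cob_cons IH opBr (subACA (op _ _)) [LHS]subACA.
Qed.

(** The formula is built from [op], sums and differences, so an additive endomorphism of [op] passes
    through. It is used for left multiplication by [P x]. *)
Lemma cob_comp (phi : H -> H) P w s :
    (forall x y, phi (op x y) = op (phi x) (phi y)) ->
    (forall x y, phi (x - y) = phi x - phi y) ->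
  cob (phi \o P) (phi \o w) s = phi (cob P w s).
Proof.
move=> phi_op phiB.
have phiD x y : phi (x + y) = phi x + phi y.
  by apply/eqP; rewrite -subr_eq -phiB addrK.
elim: s P w => [|x [|y [|z s]] IH] P w.
- by have /= := phiB 0 0; rewrite !subrr.
- by rewrite /= !subr0 phiB phi_op.
- by rewrite !cob2 phiD phiB !phi_op.
by rewrite !cob_cons !phiB phi_op -IH.
Qed.

Lemma cob_map x P w s : M x ->
  cob (P \o op x) (fun u => w (map (op x) u)) s = cob P w (map (op x) s).
Proof.
move=> Mx; elim: s P w => [|y [|z [|t s]] IH] P w //.
  by rewrite !cob2 /= opD.
have mapE u : map (op x) (map (op y) u) = map (op (op x y)) (map (op x) u).
  by rewrite -!map_comp; apply: eq_map => v /=; rewrite opD.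
rewrite cob_cons [RHS](cob_cons P w (op x y) (op x z) (op x t) (map (op x) s)).
congr (_ - _ - _); first by rewrite mapE.
rewrite -(IH (P \o op (op x y)) (fun u => w (op x y :: u))).
by congr cob; apply/funext => v /=; rewrite opD.
Qed.

Variable tan : H -> H -> Prop.
Hypothesis tanB : forall m x y, tan m x -> tan m y -> tan m (x - y).
Hypothesis tan_opl : forall m x v, M x -> tan m v -> tan (op x m) (op x v).
Hypothesis tan_opr : forall m x v, M x -> tan m v -> tan (op m x) (op v x).
Hypothesis tan_opD : forall m v y z, M m -> tan m v ->
  op v (op y z) = op (op v y) (op m z) + op (op m y) (op v z).

Lemma tanD m x y : tan m x -> tan m y -> tan m (x + y).
Proof.
move=> tx ty; rewrite -[y]opprK; apply: tanB => //; rewrite -sub0r.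
by apply: tanB => //; rewrite -(subrr x); apply: tanB.
Qed.

(** All terms are tangent at the same point [P (opr s)]: multiplicativity of [P] and
    self-distributivity, in the form of [opr_map], identify the products attached to them. *)
Lemma tan_cob P w s : op_endo P -> (1 < size s)%N -> all M s ->
    (forall u, all M u -> size u = (size s).-1 -> tan (P (opr u)) (w u)) ->
  tan (P (opr s)) (cob P w s).
Proof.
elim: s P w => [|x [|y [|z s]] IH] P w // [Pop PM] _ Ms tw.
  case/and3P: (Ms) => Mx My _; rewrite cob2 [opr _]/= Pop; apply: tanD.
    apply: tanB.
      by apply: tan_opl; [exact: PM|apply: (tw [:: y]) => //=; rewrite My].
    by rewrite -Pop; apply: (tw [:: op x y]) => //=; rewrite M_op.
  by apply: tan_opr; [exact: PM|apply: (tw [:: x]) => //=; rewrite Mx].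
have /andP[Mx Ms'] : M x && all M [:: y, z & s] := Ms.
rewrite cob_cons opr_cons //.
apply: tanB; first apply: tanB.
- by rewrite Pop; apply: tan_opl; [exact: PM|apply: tw].
- by rewrite -opr_map //; apply: tw; rewrite ?all_op ?size_map.
apply: (IH (P \o op x)) => // [|u Mu su]; first exact: op_endo_op.
rewrite /= -opr_cons; last by rewrite -size_eq0 su.
by apply: tw; rewrite /= ?su ?Mx.
Qed.

(** Let D and D' be the coboundaries with prefixes [P] and [P \o op x], L the left multiplication of
    values by [P x], and S the translation of arguments by [x]. The recursion reads (D w)(x, -) = L
    w - S w - D' (w (x, -)). Since L D = D' L by [cob_comp] and S D = D' S by [cob_map], all of (D D
    w)(x, -) cancels except D' D' (w (x, -)), which vanishes by induction. The induction starts at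
    three arguments, where the Leibniz rule enters. *)
Lemma cob_cob P w s : op_endo P -> (2 < size s)%N -> all M s ->
    (forall u, all M u -> size u = (size s).-2 -> tan (P (opr u)) (w u)) ->
  cob P (cob P w) s = 0.
Proof.
elim: s P w => [|x [|y [|z s]] IH] P w // [Pop PM] _ Ms tw.
case: s IH Ms tw => [|t s] IH Ms tw.
  case/and4P: Ms => Mx My Mz _; rewrite cob_cons [map _ _]/= !cob2 /=.
  rewrite !Pop !(opBr, opBl, opDl, opDr).
  have [PMx PMy PMz] : [/\ M (P x), M (P y) & M (P z)] by split; apply: PM.
  (* [tan_opD] expands the product of [w [:: x]] with [op (P y) (P z)]; the other products are
     rearranged by self-distributivity. *)
  rewrite !(opD _ _ PMx) (opD _ _ Mx) (tan_opD _ _ PMx (tw [:: x] _ _)) //=;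
    last by rewrite Mx.
  apply/eqP; rewrite subr_eq0; apply/eqP; set g := op _ (op (w [:: x]) (P z)).
  rewrite [_ - _ + (_ + g)]addrA [_ - _ + _ + g]addrC addrKA.
  rewrite [in RHS]opprD [_ - _ + (_ - _)]addrA [X in _ = _ + X]addrC subrKA.
  by rewrite subACA [RHS]addrACA -opprD.
set s1 := [:: y, z, t & s] in IH Ms tw *.
have /andP[Mx Ms'] : M x && all M s1 := Ms.
have Px := op_endo_op (conj Pop PM) Mx.
have -> : cob P (cob P w) (x :: s1)
    = op (P x) (cob P w s1) - cob P w (map (op x) s1)
      - cob (P \o op x) (fun u => cob P w (x :: u)) s1 by [].
(* The recursion applies to [x :: u] only if [u] has at least two entries, which the length
   condition of [eq_cob] guarantees. *)
rewrite (@eq_cob _ (P \o op x) (fun u => cob P w (x :: u))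
  (fun u => op (P x) (w u) - w (map (op x) u)
    - cob (P \o op x) (fun u' => w (x :: u')) u)) //;
  last by case=> [|a [|b u]].
rewrite (cobB _ (fun u => op (P x) (w u) - w (map (op x) u))) cobB cob_map //.
rewrite (IH (P \o op x) (fun u => w (x :: u))) // => [|u Mu su]; last first.
  rewrite /= -opr_cons; last by rewrite -size_eq0 su.
  by apply: tw; rewrite /= ?su ?Mx.
have <- : cob (op (P x) \o P) (op (P x) \o w) s1 = op (P x) (cob P w s1).
  by apply: cob_comp => a b; rewrite ?opBr // opD //; exact: PM.
rewrite (_ : P \o op x = op (P x) \o P) ?subr0 ?subrr //.
exact/funext/(Pop x).
Qed.

End SelfDistributive.

(** * The module of linear maps *)

Section LinearMaps.
Variables (K : comNzRingType) (U V : lmodType K).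
Implicit Types f g h : {linear U -> V}.

(** Function extensionality together with irrelevance of the linearity proofs; cochain identities
    can then be rewritten as equations between bundled maps. *)
Lemma linear_ext f g : f =1 g -> f = g.
Proof.
case: f g => [f [[Df] [Zf]]] [g [[Dg] [Zg]]] /= /funext fg.
subst g; by rewrite (Prop_irrelevance Df Dg) (Prop_irrelevance Zf Zg).
Qed.

HB.instance Definition _ := gen_eqMixin {linear U -> V}.
HB.instance Definition _ := gen_choiceMixin {linear U -> V}.

Definition lin_add f g : {linear U -> V} := f \+ g.
Definition lin_opp f : {linear U -> V} := \- f.
Definition lin_zero : {linear U -> V} := \0.
Definition lin_scale (a : K) f : {linear U -> V} := a \*: f.

Lemma lin_addA : associative lin_add.
Proof. by move=> f g h; apply: linear_ext => x /=; rewrite addrA. Qed.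
Lemma lin_addC : commutative lin_add.
Proof. by move=> f g; apply: linear_ext => x /=; rewrite addrC. Qed.
Lemma lin_add0 : left_id lin_zero lin_add.
Proof. by move=> f; apply: linear_ext => x /=; rewrite add0r. Qed.
Lemma lin_addN : left_inverse lin_zero lin_opp lin_add.
Proof. by move=> f; apply: linear_ext => x /=; rewrite addNr. Qed.

HB.instance Definition _ :=
  GRing.isZmodule.Build {linear U -> V} lin_addA lin_addC lin_add0 lin_addN.

Lemma lin_scaleA a b f : lin_scale a (lin_scale b f) = lin_scale (a * b) f.
Proof. by apply: linear_ext => x /=; rewrite scalerA. Qed.
Lemma lin_scale1 : left_id 1 lin_scale.
Proof. by move=> f; apply: linear_ext => x /=; rewrite scale1r. Qed.
Lemma lin_scaleDr : right_distributive lin_scale +%R.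
Proof. by move=> a f g; apply: linear_ext => x /=; rewrite scalerDr. Qed.
Lemma lin_scaleDl f : {morph lin_scale^~ f : a b / a + b}.
Proof. by move=> a b; apply: linear_ext => x /=; rewrite scalerDl. Qed.

HB.instance Definition _ := GRing.Zmodule_isLmodule.Build K {linear U -> V}
  lin_scaleA lin_scale1 lin_scaleDr lin_scaleDl.

Lemma lin_addE f g x : (f + g) x = f x + g x. Proof. by []. Qed.
Lemma lin_subE f g x : (f - g) x = f x - g x. Proof. by []. Qed.
Lemma lin_scaleE a f x : (a *: f) x = a *: f x. Proof. by []. Qed.
Lemma lin_sumE (I : Type) (r : seq I) (F : I -> {linear U -> V}) x :
  (\sum_(i <- r) F i) x = \sum_(i <- r) F i x.
Proof.
by elim: r => [|i r IH]; rewrite ?big_nil // !big_cons lin_addE IH.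
Qed.

End LinearMaps.

(** * Functoriality of tensor products and naturality of their rebracketings *)

Section Tensors.
Variable K : comNzRingType.
Implicit Types U V W : lmodType K.

Lemma tens_ext U V W (f g : {linear tens U V -> W}) :
  (forall x y, f (x \ox y) = g (x \ox y)) -> f =1 g.
Proof.
by move=> fg; elim/tens_ind => // z z' IH IH'; rewrite !linearD IH IH'.
Qed.

(** A representative of [z] writes it as a sum of pure tensors, and [f] is additive. This turns
    Sweedler sums into values of linear maps. *)
Lemma tlift_pure U V W (f : {linear tens U V -> W}) z :
  tlift (fun x y => f (x \ox y)) z = f z.
Proof.
rewrite /tlift -[in RHS](tsumK z) tsumE linear_sum.
by apply: eq_bigr => -[].
Qed.

Lemma tmap_comp U V U' V' U'' V'' (f : {linear U -> U'}) (g : {linear V -> V'})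
    (f' : {linear U' -> U''}) (g' : {linear V' -> V''}) z :
  tmap f' g' (tmap f g z) = tmap (f' \o f) (g' \o g) z.
Proof.
elim/tens_ind: z => [x y|z z' IH IH']; first by rewrite !tmapE.
by rewrite !linearD /= IH IH'.
Qed.

Lemma eq_tmap U V U' V' (f f' : {linear U -> U'}) (g g' : {linear V -> V'}) z :
  f =1 f' -> g =1 g' -> tmap f g z = tmap f' g' z.
Proof. by move=> /linear_ext -> /linear_ext ->. Qed.

Lemma tmap_id U V (z : tens U V) : tmap idfun idfun z = z.
Proof.
elim/tens_ind: z => [x y|z z' IH IH']; first by rewrite tmapE.
by rewrite linearD /= IH IH'.
Qed.

Lemma tmapLE U V U' V' (f : {linear U -> U'}) (g : {linear V -> V'}) x y :
  (tmap f g : {linear _ -> _}) (x \ox y) = f x \ox g y.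
Proof. exact: tmapE. Qed.

Lemma tmid_tmap U V U' V' U1 V1 U1' V1' (a : {linear U -> U1})
    (b : {linear V -> V1}) (c : {linear U' -> U1'}) (d : {linear V' -> V1'}) z :
  tmid (tmap (tmap a b) (tmap c d) z) = tmap (tmap a c) (tmap b d) (tmid z).
Proof.
elim/tens_ind: z => [x y|z z' IH IH']; last by rewrite !linearD /= IH IH'.
rewrite tmapE; elim/tens_ind: x => [x x'|z z' IH IH']; last first.
  by rewrite !(linearD, tpureDl) /= IH IH'.
elim/tens_ind: y => [y y'|z z' IH IH']; last first.
  by rewrite !(linearD, tpureDr) /= IH IH'.
by rewrite tmidE !(tmapE, tmapLE, tmidE).
Qed.

(** The inverse associator, obtained by rotating the factors: x (y z), (y z) x, y (z x), (z x) y, z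
    (x y), (x y) z. *)
Definition tassocV U V W : tens U (tens V W) -> tens (tens U V) W :=
  tswap \o tassoc \o tswap \o tassoc \o tswap.

HB.instance Definition _ U V W := GRing.Linear.on (@tassocV U V W).

Lemma tassocVE U V W x y z : @tassocV U V W (x \ox (y \ox z)) = (x \ox y) \ox z.
Proof. by rewrite /tassocV /= !(tswapE, tassocE). Qed.

Lemma tassocK U V W : cancel (@tassoc K U V W) (@tassocV U V W).
Proof.
move=> z; elim/tens_ind: z => [x y|z z' IH IH']; last first.
  by rewrite !linearD /= IH IH'.
elim/tens_ind: x => [x x'|z z' IH IH']; last first.
  by rewrite !(linearD, tpureDl) /= IH IH'.
by rewrite tassocE tassocVE.
Qed.

Lemma tassoc_tmap U V W U' V' W' (a : {linear U -> U'}) (b : {linear V -> V'})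
    (c : {linear W -> W'}) z :
  tassoc (tmap (tmap a b) c z) = tmap a (tmap b c) (tassoc z).
Proof.
elim/tens_ind: z => [x y|z z' IH IH']; last by rewrite !linearD /= IH IH'.
elim/tens_ind: x => [x x'|z z' IH IH']; last first.
  by rewrite !(linearD, tpureDl) /= IH IH'.
by rewrite !(tmapE, tmapLE, tassocE).
Qed.

End Tensors.
Arguments tassocV {K U V W}.

(** * Cocommutative coalgebras *)

Section Cocommutative.
Variables (K : comNzRingType).

Lemma tens_cocommutative (C D : coalgebra K) :
  cocommutative C -> cocommutative D -> cocommutative (tens_coalgebra C D).
Proof.
move=> CC CD z; rewrite /= /tens_comul /=.
elim/tens_ind: z => [x y|z z' IH IH']; last by rewrite !linearD /= IH IH'.
have sw (u : tens C C) (v : tens D D) :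
    tswap (tmid (u \ox v)) = tmid (tswap u \ox tswap v).
  elim/tens_ind: u => [x1 y1|z z' IH IH']; last first.
    by rewrite !(linearD, tpureDl) /= IH IH'.
  elim/tens_ind: v => [x2 y2|z z' IH IH']; last first.
    by rewrite !(linearD, tpureDr) /= IH IH'.
  by rewrite !(tmidE, tswapE).
by rewrite tmapE sw CC CD.
Qed.

Variable T : coalgebra K.
Hypothesis T_cocomm : cocommutative T.

(* Both sides are rebracketings of the iterated comultiplication
   t1 \ox ((t2 \ox t3) \ox t4), and tmid exchanges t2 and t3. *)
Lemma comul_morphism (t : T) :
  tmid (tmap comul comul (comul t)) = tmap comul comul (comul t).
Proof.
pose alpha :
    {linear tens T (tens (tens T T) T) -> tens (tens T T) (tens T T)} :=
  tassocV \o tmap idfun tassoc.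
have alphaP a b c d : alpha (a \ox (b \ox c \ox d)) = (a \ox b) \ox (c \ox d).
  by rewrite /alpha /= tmapE /= tassocE tassocVE.
have alphaE : tmap comul comul (comul t)
    = alpha (tmap idfun (tmap comul idfun \o comul) (comul t)).
  rewrite -[LHS]tassocK; congr (tassocV _); rewrite /= tmap_comp.
  have -> : tmap comul comul (comul t)
      = tmap (tmap idfun idfun) comul (tmap comul idfun (comul t)).
    by rewrite tmap_comp; apply: eq_tmap => // z /=; rewrite tmap_id.
  rewrite tassoc_tmap comulA tmap_comp; apply: eq_tmap => // z /=.
  by rewrite comulA.
have mid_alpha z : tmid (alpha z) = alpha (tmap idfun (tmap tswap idfun) z).
  elim/tens_ind: z => [x y|z z' IH IH']; last by rewrite !linearD /= IH IH'.
  elim/tens_ind: y => [y d|z z' IH IH']; last first.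
    by rewrite !(linearD, tpureDr) /= IH IH'.
  elim/tens_ind: y => [b c|z z' IH IH']; last first.
    by rewrite !(linearD, tpureDr, tpureDl) /= IH IH'.
  rewrite tmapE tmapLE -[RHS]/(alpha (x \ox (tswap (b \ox c) \ox d))).
  by rewrite tswapE !alphaP tmidE.
rewrite alphaE mid_alpha tmap_comp; congr (alpha _); apply: eq_tmap => // z /=.
by rewrite tmap_comp; apply: eq_tmap => // u /=; rewrite T_cocomm.
Qed.

End Cocommutative.

Definition lcomp (K : comNzRingType) (U V W : lmodType K) (g : {linear V -> W})
  (f : {linear U -> V}) : {linear U -> W} := g \o f.
Notation "g \oL f" := (lcomp g f) (at level 40, left associativity).

Lemma lcompDr (K : comNzRingType) (U V W : lmodType K) (g : {linear V -> W})
  (f f' : {linear U -> V}) : g \oL (f + f') = g \oL f + g \oL f'.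
Proof. by apply: linear_ext => t; exact: linearD. Qed.

(** * Convolution, comorphisms and tangent vectors *)

Section Convolution.
Variables (K : comNzRingType) (T : coalgebra K).
Implicit Types U V W : lmodType K.

(** The linear counterpart of pairing two maps, t |-> (f t, g t). *)
Definition cv U V (f : {linear T -> U}) (g : {linear T -> V}) :
  {linear T -> tens U V} := tmap f g \o comul.

Lemma tmap_cv U V U' V' (a : {linear U -> U'}) (b : {linear V -> V'})
    (f : {linear T -> U}) (g : {linear T -> V}) :
  (tmap a b) \oL cv f g = cv (a \oL f) (b \oL g).
Proof. by apply: linear_ext => t; rewrite /= tmap_comp. Qed.

Lemma cvDl U V (f f' : {linear T -> U}) (g : {linear T -> V}) :
  cv (f + f') g = cv f g + cv f' g.
Proof.
apply: linear_ext => t; rewrite lin_addE /=.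
elim/tens_ind: (comul t) => [x y|z z' IH IH']; first by rewrite !tmapE tpureDl.
by rewrite !linearD /= IH IH' addrACA.
Qed.

Lemma cvDr U V (f : {linear T -> U}) (g g' : {linear T -> V}) :
  cv f (g + g') = cv f g + cv f g'.
Proof.
apply: linear_ext => t; rewrite lin_addE /=.
elim/tens_ind: (comul t) => [x y|z z' IH IH']; first by rewrite !tmapE tpureDr.
by rewrite !linearD /= IH IH' addrACA.
Qed.

Lemma cvNl U V (f : {linear T -> U}) (g : {linear T -> V}) :
  cv (- f) g = - cv f g.
Proof.
apply/eqP; rewrite -addr_eq0 -cvDl addNr.
by apply/eqP/(addIr (cv 0 g)); rewrite -cvDl !add0r.
Qed.

Lemma cvNr U V (f : {linear T -> U}) (g : {linear T -> V}) :
  cv f (- g) = - cv f g.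
Proof.
apply/eqP; rewrite -addr_eq0 -cvDr addNr.
by apply/eqP/(addIr (cv f 0)); rewrite -cvDr !add0r.
Qed.

Hypothesis T_cocomm : cocommutative T.

(** Cocommutativity enters through [comul_morphism]: the middle two of four copies of t may be
    exchanged. The closure properties of comorphisms and tangent vectors rest on this
    interchange. *)
Lemma cv_mid U V U' V' (a : {linear T -> U}) (b : {linear T -> V})
    (c : {linear T -> U'}) (d : {linear T -> V'}) :
  tmid \oL cv (cv a b) (cv c d) = cv (cv a c) (cv b d).
Proof.
apply: linear_ext => t.
have cv2 U1 V1 U2 V2 (f : {linear T -> U1}) (g : {linear T -> V1})
    (f' : {linear T -> U2}) (g' : {linear T -> V2}) :
    cv (cv f g) (cv f' g') t
    = tmap (tmap f g) (tmap f' g') (tmap comul comul (comul t)).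
  by rewrite /= tmap_comp.
by rewrite -[LHS]/(tmid (cv (cv a b) (cv c d) t)) !cv2 tmid_tmap comul_morphism.
Qed.

(* Only the comultiplication is required to be preserved. *)
Definition comorphism (D : coalgebra K) (x : {linear T -> D}) :=
  comul \oL x = cv x x.

Section Rack.
Variable R : rack_bialgebra K.
Implicit Types x y z m v : {linear T -> R}.

Definition conv x y : {linear T -> R} := rack_mul R \oL cv x y.

Lemma convDl x y z : conv (x + y) z = conv x z + conv y z.
Proof. by rewrite /conv cvDl lcompDr. Qed.

Lemma convDr x y z : conv x (y + z) = conv x y + conv x z.
Proof. by rewrite /conv cvDr lcompDr. Qed.

Lemma convBl x y z : conv (x - y) z = conv x z - conv y z.
Proof. by apply/eqP; rewrite eq_sym subr_eq -convDl subrK. Qed.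

Lemma convBr x y z : conv x (y - z) = conv x y - conv x z.
Proof. by apply/eqP; rewrite eq_sym subr_eq -convDr subrK. Qed.

Lemma comul_conv x y :
  comul \oL conv x y =
  tmap (rack_mul R) (rack_mul R) \oL (tmid \oL cv (comul \oL x) (comul \oL y)).
Proof.
apply: linear_ext => t; rewrite /= (rack_mul_morphism R).1 /=.
congr (tmap _ _ _).
by rewrite /tens_comul /= tmap_comp.
Qed.

Definition comorphisms : pred {linear T -> R} := fun x => `[< comorphism x >].

Lemma comorphisms_conv x y :
  comorphisms x -> comorphisms y -> comorphisms (conv x y).
Proof.
move=> /asboolP Mx /asboolP My; apply/asboolP.
by rewrite /comorphism comul_conv Mx My cv_mid tmap_cv.
Qed.

(** For [T] a tensor power of [R], this is [coder m v] as an equation between linear maps. *)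
Definition tangent m v := comul \oL v = cv v m + cv m v.

Lemma tangentB m v v' : tangent m v -> tangent m v' -> tangent m (v - v').
Proof.
move=> tv tv'; rewrite /tangent.
have -> : comul \oL (v - v') = (comul \oL v) - (comul \oL v').
  by apply: linear_ext => t; exact: linearB.
by rewrite tv tv' cvDl cvDr cvNl cvNr opprD addrACA.
Qed.

Lemma tangent_convl m x v :
  comorphisms x -> tangent m v -> tangent (conv x m) (conv x v).
Proof.
move=> /asboolP Mx tv; rewrite /tangent comul_conv Mx tv cvDr.
by rewrite !lcompDr !cv_mid !tmap_cv.
Qed.

Lemma tangent_convr m x v :
  comorphisms x -> tangent m v -> tangent (conv m x) (conv v x).
Proof.
move=> /asboolP Mx tv; rewrite /tangent comul_conv Mx tv cvDl.
by rewrite !lcompDr !cv_mid !tmap_cv.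
Qed.

(** Self-distributivity freed of Sweedler components, so that it can be composed with
    convolutions. *)
Lemma rack_mul_selfdistr (u : tens R (tens R R)) :
  rack_mul R (tmap idfun (rack_mul R) u) =
  rack_mul R (tmap (rack_mul R) (rack_mul R) (tmid (tmap comul idfun u))).
Proof.
elim/tens_ind: u => [a u|z z' IH IH']; last by rewrite !linearD /= IH IH'.
elim/tens_ind: u => [b c|z z' IH IH']; last first.
  by rewrite !(linearD, tpureDr) /= IH IH'.
rewrite !tmapE /= rack_selfdistr.
have gl : linear (fun z : tens R R =>
    rack_mul R (tmap (rack_mul R) (rack_mul R) (tmid (z \ox (b \ox c))))).
  by move=> k z z'; rewrite tpureDl tpureZl !linearP.
(* The right side is linear in the coproduct of [a]; bundled as [g], it expands over the Sweedler
   components by [tlift_pure]. *)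
have [g gE] := linear_bundle gl; rewrite -gE -tlift_pure.
by congr tlift; apply/funext => a1; apply/funext => a2; rewrite gE tmidE tmapE.
Qed.

(** On the right [x] enters only through [comul \oL x], so one formula yields self-distributivity
    when this is [cv x x] and the Leibniz rule when it is [cv x m + cv m x]. *)
Lemma conv_conv x y z :
  conv x (conv y z) =
  rack_mul R \oL (tmap (rack_mul R) (rack_mul R)
                  \oL (tmid \oL cv (comul \oL x) (cv y z))).
Proof.
apply: linear_ext => t.
have := rack_mul_selfdistr (cv x (cv y z) t).
by rewrite /= !tmap_comp.
Qed.

Lemma conv_selfdistr x y z :
  comorphisms x -> conv x (conv y z) = conv (conv x y) (conv x z).
Proof. by move=> /asboolP Mx; rewrite conv_conv Mx cv_mid tmap_cv. Qed.

Lemma tangent_conv_conv m v y z : tangent m v ->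
  conv v (conv y z) = conv (conv v y) (conv m z) + conv (conv m y) (conv v z).
Proof.
by move=> tv; rewrite conv_conv tv cvDl !lcompDr !cv_mid !tmap_cv.
Qed.

End Rack.
End Convolution.

(** * Tuples of linear maps as points of tensor powers *)

Section Tuples.
Variables (K : comNzRingType) (T : coalgebra K) (R : rack_bialgebra K).
Implicit Types (x y : {linear T -> R}) (s : seq {linear T -> R}).

(** The tensor product of the entries of [s] after the iterated comultiplication of [T]; meant for
    lists of size [n]. *)
Fixpoint tup n s : {linear T -> tpow R n} :=
  match n with
  | 0 => counit
  | m.+1 =>
    match m return {linear T -> tpow R m} -> {linear T -> tpow R m.+1} with
    | 0 => fun=> head 0 s
    | _ => fun f => cv (head 0 s) f
    end (tup m (behead s))
  end.

Lemma tup1 x : tup 1 [:: x] = x. Proof. by []. Qed.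

Lemma tup_cons n x s : tup n.+2 (x :: s) = cv x (tup n.+1 s).
Proof. by []. Qed.

Lemma rack_pow_tup n s : size s = n.+1 ->
  rack_pow R n.+1 \oL tup n.+1 s = opr (@conv _ _ _) s.
Proof.
elim: n s => [|n IH] [|x s] // [sn].
  by case: s sn => // _; apply: linear_ext.
rewrite tup_cons opr_cons -?size_eq0 ?sn // -IH //.
by apply: linear_ext => t; rewrite /= tmap_comp.
Qed.

Hypothesis T_cocomm : cocommutative T.

Lemma comul_cv (C D : coalgebra K) (f : {linear T -> C}) (g : {linear T -> D}) :
  @comul K (tens_coalgebra C D) \oL cv f g =
  tmid \oL cv (comul \oL f) (comul \oL g).
Proof. by apply: linear_ext => t; rewrite /= /tens_comul /= tmap_comp. Qed.

Lemma comorphism_tup n s :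
  all (@comorphisms _ _ _) s -> size s = n.+1 -> comorphism (tup n.+1 s).
Proof.
elim: n s => [|n IH] [|x s] //= /andP[/asboolP Mx Ms] [sn].
  by case: s sn {Ms}.
have Mt := IH _ Ms sn; rewrite /comorphism.
by rewrite (@comul_cv R (tpow R n.+1)) Mx Mt cv_mid.
Qed.

End Tuples.
Arguments tup : simpl never.
Arguments tup {K T R} n s.

(** * The Sweedler formulas as linear maps, and their evaluation on tuples *)

Section Forms.
Variables (K : comNzRingType) (R : rack_bialgebra K).
Implicit Types V : lmodType K.

Lemma tpow_ext V n (f g : {linear tpow R n.+1 -> V}) :
    (forall r, size r = n.+1 -> f (ptens n.+1 r) = g (ptens n.+1 r)) -> f = g.
Proof.
elim: n V f g => [|n IH] V f g fg; apply: linear_ext.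
  by move=> x; exact: (fg [:: x]).
apply: tens_ext => x z.
have E (h : {linear tens R (tpow R n.+1) -> V}) : linear (fun z => h (x \ox z)).
  by move=> a u v; rewrite tpureDr tpureZr linearP.
have [f' fE] := linear_bundle (E f); have [g' gE] := linear_bundle (E g).
rewrite -[LHS]fE -[RHS]gE; suff -> : f' = g' by [].
apply: IH => r rn.
by rewrite [LHS]fE [RHS]gE; apply: (fg (x :: r)); rewrite /= rn.
Qed.

(* For i <= n, it maps r_1 \ox ... \ox r_(n+2) to the tensor product of
   r_1^(1) \ox ... \ox r_i^(1) \ox r_(i+1) and
   r_1^(2) \ox ... \ox r_i^(2) \ox r_(i+2) \ox ... \ox r_(n+2). *)
Fixpoint split_at i n :
    {linear tpow R n.+2 -> tens (tpow R i.+1) (tpow R n.+1)} :=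
  match i with
  | 0 => idfun
  | i'.+1 =>
    match n with
    | 0 => 0
    | n'.+1 => tmid \o tmap comul (split_at i' n')
    end
  end.

Lemma split_atSS i n (x : R) (z : tpow R n.+2) :
  split_at i.+1 n.+1 (x \ox z) = tmid (comul x \ox split_at i n z).
Proof. by rewrite /= tmapE. Qed.

(** Each argument peeled off contributes one coproduct, expanded by [tlift_pure], and [tmid] hands
    its two parts to the two blocks. *)
Lemma sweedler2_split V i n
    (f : {linear tens (tpow R i.+1) (tpow R n.+1) -> V}) (r : seq R) :
  (i <= n)%N -> size r = n.+2 ->
  sweedler2 (take i r) (fun s1 s2 =>
    f (ptens i.+1 (rcons s1 (nth 0 r i)) \ox ptens n.+1 (s2 ++ drop i.+1 r)))
  = f (split_at i n (ptens n.+2 r)).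
Proof.
elim: i n f r => [|i IH] [|n] f [|a r] // le_in [rn].
- by rewrite /= drop0.
- by rewrite /= drop0.
set S := split_at i n (ptens n.+2 r).
have fl (u : tens R R) : linear (fun z => f (tmid (u \ox z))).
  by move=> k z z'; rewrite tpureDr tpureZr !linearP.
have fr : linear (fun u : tens R R => f (tmid (u \ox S))).
  by move=> k u u'; rewrite tpureDl tpureZl !linearP.
rewrite ptensSS split_atSS -/S.
have [g gE] := linear_bundle fr; rewrite -[RHS]gE -tlift_pure /=.
congr tlift; apply/funext => a1; apply/funext => a2; rewrite gE.
have [h hE] := linear_bundle (fl (a1 \ox a2)).
rewrite -hE -IH //; congr sweedler2; apply/funext => s1; apply/funext => s2.
by rewrite hE tmidE.
Qed.

(** The diagonal left action of [R] on [n.+1] tensor factors. *)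
Fixpoint act n : {linear tens R (tpow R n.+1) -> tpow R n.+1} :=
  match n with
  | 0 => rack_mul R
  | n'.+1 => tmap (rack_mul R) (act n') \o tmid \o tmap comul idfun
  end.

Lemma actS n (a b : R) (z : tpow R n.+1) :
  act n.+1 (a \ox (b \ox z)) =
  tmap (rack_mul R) (act n) (tmid (comul a \ox (b \ox z))).
Proof. by rewrite /= tmapE. Qed.

Lemma sweedler_act V n (f : {linear tpow R n.+1 -> V}) (a : R) (r : seq R) :
  size r = n.+1 ->
  sweedler n.+1 a (fun s => f (ptens n.+1 [seq rhd p.1 p.2 | p <- zip s r]))
  = f (act n (a \ox ptens n.+1 r)).
Proof.
elim: n f a r => [|n IH] f a [|b r] // [rn].
rewrite ptensSS actS sweedlerSS [head 0 _]/= [behead _]/=.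
set S := ptens n.+1 r.
have fr : linear (fun u : tens R R =>
    f (tmap (rack_mul R) (act n) (tmid (u \ox (b \ox S))))).
  by move=> k u u'; rewrite tpureDl tpureZl !linearP.
have [g gE] := linear_bundle fr; rewrite -[RHS]gE -tlift_pure /=.
congr tlift; apply/funext => a1; apply/funext => a2; rewrite gE tmidE tmapE.
have fl : linear (fun z => f (rack_mul R (a1 \ox b) \ox z)).
  by move=> k z z'; rewrite tpureDr tpureZr !linearP.
have [h hE] := linear_bundle fl.
by rewrite -hE -IH //; congr sweedler; apply/funext => s1; rewrite hE.
Qed.

(** The factor at position [i], counted from 0, acts on those after it. Only [i <= n] is meaningful;
    the zero map fills the other cases. *)
Fixpoint act_at i n : {linear tpow R n.+2 -> tpow R n.+1} :=
  match i with
  | 0 => act n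
  | i'.+1 =>
    match n with
    | 0 => 0
    | n'.+1 => tmap idfun (act_at i' n')
    end
  end.

Lemma act_atSS i n (x : R) (z : tpow R n.+2) :
  act_at i.+1 n.+1 (x \ox z) = x \ox act_at i n z.
Proof. by rewrite /= tmapE. Qed.

Lemma sweedler_act_at V i n (f : {linear tpow R n.+1 -> V}) (r : seq R) :
  (i <= n)%N -> size r = n.+2 ->
  sweedler (n.+1 - i) (nth 0 r i) (fun a =>
    f (ptens n.+1 (take i r ++ [seq rhd p.1 p.2 | p <- zip a (drop i.+1 r)])))
  = f (act_at i n (ptens n.+2 r)).
Proof.
elim: i n f r => [|i IH] n f [|a r] // le_in [rn].
  by rewrite /= drop0; exact: sweedler_act.
case: n f le_in rn => // n f le_in rn; rewrite ptensSS act_atSS.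
have fl : linear (fun z => f (a \ox z)).
  by move=> k z z'; rewrite tpureDr tpureZr !linearP.
have [h hE] := linear_bundle fl; rewrite -[RHS]hE -IH //.
by congr sweedler; apply/funext => s; rewrite hE.
Qed.

(** Free of elements, the formula can be composed with [tup]. The index is lowered by one, so the
    sign (-1)^(i+2) becomes (-1)^i. *)
Lemma coboundary_linE n (w : {linear tpow R n.+1 -> R}) :
  coboundary w =
    \sum_(0 <= i < n.+1) (-1) ^+ i *:
      (rack_mul R \oL (tmap (rack_pow R i.+1) w \oL split_at i n)
       - w \oL act_at i n)
    + (-1) ^+ n *: (rack_mul R \oL (tmap w (rack_pow R n.+1) \oL split_at n n))
  :> {linear tpow R n.+2 -> R}.
Proof.
have sgE i : (-1) ^+ i.+2 = (-1) ^+ i :> K by rewrite !exprS !mulN1r opprK.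
apply: tpow_ext => r rn.
transitivity (cobound_form w r); first exact: coboundaryE.
rewrite lin_addE lin_sumE lin_scaleE.
rewrite /cobound_form big_add1 sgE; congr (_ + _ *: _).
  apply: eq_big_nat => i /andP[_ le_in].
  rewrite sgE lin_scaleE lin_subE; congr (_ *: (_ - _)).
    rewrite /cobound1 /entry /=.
    pose f := rack_mul R \oL tmap (rack_pow R i.+1) w.
    apply: etrans (sweedler2_split f _ rn) => //; congr sweedler2.
    by apply/funext => s1; apply/funext => s2; rewrite /= tmapE.
  by rewrite /cobound0 /entry subSS; exact: sweedler_act_at.
rewrite /cobound_last /entry /=.
pose f := rack_mul R \oL tmap w (rack_pow R n.+1).
apply: etrans (sweedler2_split f _ rn) => //.
congr sweedler2; apply/funext => s1; apply/funext => s2; rewrite /= tmapE.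
(* [drop n.+1 r] consists of the last argument alone. *)
by rewrite (drop_nth 0) ?rn // drop_oversize ?rn // cats1.
Qed.

Section Evaluation.
Variable T : coalgebra K.
Hypothesis T_cocomm : cocommutative T.
Implicit Types (x : {linear T -> R}) (s : seq {linear T -> R}).

(** The comultiplication duplicates a comorphism like an element of a set, so the entries before
    position [i] occur in both tuples. *)
Lemma split_at_tup i n s :
    all (@comorphisms _ _ _) s -> size s = n.+2 -> (i <= n)%N ->
  split_at i n \oL tup n.+2 s =
  cv (tup i.+1 (take i.+1 s)) (tup n.+1 (take i s ++ drop i.+1 s)).
Proof.
elim: i n s => [|i IH] n [|x s] // Ms [sn] le_in.
  by rewrite take0 /= drop0 take0 tup1; apply: linear_ext.
case: n sn le_in => // n sn le_in; case/andP: Ms => /asboolP Mx Ms.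
have -> : split_at i.+1 n.+1 \oL tup n.+3 (x :: s)
    = tmid \oL cv (comul \oL x) (split_at i n \oL tup n.+2 s).
  by apply: linear_ext => t; rewrite /= tmap_comp.
by rewrite Mx IH // cv_mid.
Qed.

Lemma act_tup n x s : comorphisms x -> size s = n.+1 ->
  act n \oL cv x (tup n.+1 s) = tup n.+1 (map (conv x) s).
Proof.
move=> /asboolP Mx; elim: n s => [|n IH] [|y s] // [sn].
have -> : act n.+1 \oL cv x (tup n.+2 (y :: s))
    = tmap (rack_mul R) (act n)
      \oL (tmid \oL cv (comul \oL x) (cv y (tup n.+1 s))).
  by apply: linear_ext => t; rewrite /= tmap_comp.
by rewrite Mx cv_mid // tmap_cv IH.
Qed.

Lemma act_at_tup i n s :
    all (@comorphisms _ _ _) s -> size s = n.+2 -> (i <= n)%N ->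
  act_at i n \oL tup n.+2 s =
  tup n.+1 (take i s ++ map (conv (nth 0 s i)) (drop i.+1 s)).
Proof.
elim: i n s => [|i IH] n [|x s] // Ms [sn] le_in.
  by case/andP: Ms => Mx _; rewrite /= drop0 -act_tup.
case: n sn le_in => // n sn le_in; case/andP: Ms => Mx Ms.
have -> : act_at i.+1 n.+1 \oL tup n.+3 (x :: s)
    = cv x (act_at i n \oL tup n.+2 s).
  by apply: linear_ext => t; rewrite /= tmap_comp.
by rewrite IH.
Qed.

Definition ev n (w : {linear tpow R n -> R}) s : {linear T -> R} :=
  w \oL tup n s.

(** On comorphisms, Sweedler components become repeated arguments, and [coboundary_linE] turns term
    by term into the expansion [cobE]. *)
Lemma ev_coboundary n (w : {linear tpow R n.+1 -> R}) s :
    all (@comorphisms _ _ _) s -> size s = n.+2 ->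
  ev (coboundary w) s = cob (@conv _ _ _) id (ev w) s.
Proof.
move=> Ms sn; have sgE i : (-1) ^+ i.+2 = (-1) ^+ i :> K.
  by rewrite !exprS !mulN1r opprK.
set p := tup n.+2 s.
have -> : ev (coboundary w) s = \sum_(0 <= i < n.+1) (-1) ^+ i *:
    (rack_mul R \oL (tmap (rack_pow R i.+1) w \oL (split_at i n \oL p))
     - w \oL (act_at i n \oL p))
    + (-1) ^+ n *:
      (rack_mul R \oL (tmap w (rack_pow R n.+1) \oL (split_at n n \oL p))).
  apply: linear_ext => t.
  have := congr1 (fun f : {linear _ -> R} => f (p t)) (coboundary_linE w).
  by rewrite !(lin_addE, lin_sumE).
have sz i : (i <= n)%N -> size (take i s ++ drop i.+1 s) = n.+1.
  by move=> i_n; rewrite size_cat size_takel ?size_drop sn; lia.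
rewrite (cobE _ _ _ sn) big_add1 sgE; congr (_ + _ *: _).
  apply: eq_big_nat => i /andP[_ i_n]; rewrite sgE; congr (_ *: (_ - _)).
    rewrite split_at_tup // tmap_cv rack_pow_tup; first by [].
    by rewrite size_takel // sn ltnW.
  by rewrite act_at_tup.
rewrite split_at_tup // tmap_cv.
by rewrite (rack_pow_tup (s := take n s ++ drop n.+1 s)) ?sz.
Qed.

End Evaluation.
End Forms.

(** * Projections of a tensor product of coalgebras, given by the counits *)

Section Projections.
Variables (K : comNzRingType) (C D : coalgebra K).

Definition tfst : {linear tens_coalgebra C D -> C} := tact counit \o tswap.
Definition tsnd : {linear tens_coalgebra C D -> D} := tact counit.

Lemma tfstE x y : tfst (x \ox y) = (counit y : K) *: x.
Proof. by rewrite /tfst /= tswapE tactE. Qed.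

Lemma tsndE x y : tsnd (x \ox y) = (counit x : K) *: y.
Proof. by rewrite /tsnd /= tactE. Qed.

Lemma comorphism_tfst : comorphism tfst.
Proof.
(* Arbitrary tensors are needed, since [comul x] and [comul y] need not be pure. *)
have E (u : tens C C) (v : tens D D) :
    tmap tfst tfst (tmid (u \ox v)) = (counit (tact counit v) : K) *: u.
  elim/tens_ind: u => [a b|z z' IH IH']; last first.
    by rewrite !(linearD, tpureDl) /= IH IH'.
  elim/tens_ind: v => [c d|z z' IH IH']; last first.
    by rewrite !(linearD, tpureDr) /= IH IH' scalerDl.
  rewrite tmidE tmapE !tfstE tactE linearZ /= tpureZl tpureZr.
  by rewrite scalerA.
apply: linear_ext; apply: tens_ext => x y.
by rewrite /= /tens_comul /= tmapE E counitl tswapE tactE linearZ.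
Qed.

Lemma comorphism_tsnd : comorphism tsnd.
Proof.
have E (u : tens C C) (v : tens D D) :
    tmap tsnd tsnd (tmid (u \ox v)) = (counit (tact counit u) : K) *: v.
  elim/tens_ind: u => [a b|z z' IH IH']; last first.
    by rewrite !(linearD, tpureDl) /= IH IH' scalerDl.
  elim/tens_ind: v => [c d|z z' IH IH']; last first.
    by rewrite !(linearD, tpureDr) /= IH IH'.
  rewrite tmidE tmapE !tsndE tactE linearZ /= tpureZl tpureZr.
  by rewrite scalerA.
apply: linear_ext; apply: tens_ext => x y.
by rewrite /= /tens_comul /= tmapE E counitl tactE linearZ.
Qed.

(** As for products of sets, pairing the projections gives the identity; the two counit axioms
    recover the factors. *)
Lemma cv_tfst_tsnd : cv tfst tsnd = (idfun : {linear _ -> _}).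
Proof.
have E (u : tens C C) (v : tens D D) :
    tmap tfst tsnd (tmid (u \ox v)) = tact counit (tswap u) \ox tact counit v.
  elim/tens_ind: u => [a b|z z' IH IH']; last first.
    by rewrite !(linearD, tpureDl) /= IH IH'.
  elim/tens_ind: v => [c d|z z' IH IH']; last first.
    by rewrite !(linearD, tpureDr) /= IH IH'.
  rewrite tmidE tmapE tfstE tsndE tswapE !tactE.
  by rewrite !tpureZl !tpureZr !scalerA mulrC.
apply: linear_ext; apply: tens_ext => x y.
by rewrite /= /tens_comul /= tmapE E counitl counitr.
Qed.

End Projections.

(** * Change of the source coalgebra along a comorphism *)

Section Precomposition.
Variables (K : comNzRingType) (S T : coalgebra K) (h : {linear S -> T}).
Hypothesis h_comor : comorphism h.

Lemma cv_lcomp (U V : lmodType K) (f : {linear T -> U}) (g : {linear T -> V}) :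
  cv f g \oL h = cv (f \oL h) (g \oL h).
Proof.
have -> : cv f g \oL h = tmap f g \oL (comul \oL h) by apply: linear_ext.
by rewrite h_comor tmap_cv.
Qed.

Lemma comorphism_lcomp (D : coalgebra K) (x : {linear T -> D}) :
  comorphism x -> comorphism (x \oL h).
Proof. by move=> Mx; rewrite /comorphism -cv_lcomp -Mx; apply: linear_ext. Qed.

Lemma tup_lcomp (R : rack_bialgebra K) n (s : seq {linear T -> R}) :
  size s = n.+1 -> tup n.+1 [seq x \oL h | x <- s] = tup n.+1 s \oL h.
Proof.
elim: n s => [|n IH] [|x s] // [sn].
by rewrite [map _ _]/= !tup_cons IH // cv_lcomp.
Qed.

End Precomposition.

(** * The generic point and the deformation complex *)

Section Main.
Variables (K : comNzRingType) (R : rack_bialgebra K).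
Hypothesis R_cocomm : cocommutative R.

Fixpoint projs n : seq {linear tpow R n.+1 -> R} :=
  match n with
  | 0 => [:: (idfun : {linear R -> R})]
  | n'.+1 => tfst R (tpow R n'.+1)
             :: [seq x \oL tsnd R (tpow R n'.+1) | x <- projs n']
  end.

Lemma size_projs n : size (projs n) = n.+1.
Proof. by elim: n => //= n IH; rewrite size_map IH. Qed.

Lemma comorphisms_projs n : all (@comorphisms _ _ _) (projs n).
Proof.
elim: n => [|n IH] /=.
  by rewrite andbT; apply/asboolP; apply: linear_ext => x; rewrite /= tmap_id.
apply/andP; split; first by apply/asboolP/comorphism_tfst.
rewrite all_map; apply/allP => x /(allP IH) /asboolP Mx /=; apply/asboolP.
exact: (comorphism_lcomp (comorphism_tsnd R (tpow R n.+1))).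
Qed.

(** Evaluating a cochain at [projs] thus returns the cochain itself, so identities on tuples of
    comorphisms become identities of linear maps. *)
Lemma tup_projs n : tup n.+1 (projs n) = (idfun : {linear _ -> _}).
Proof.
elim: n => [//|n IH]; rewrite tup_cons.
rewrite (tup_lcomp (comorphism_tsnd R (tpow R n.+1))) ?size_projs // IH.
by apply: etrans (cv_tfst_tsnd R (tpow R n.+1)); congr cv; apply: linear_ext.
Qed.

Lemma tpow_cocommutative n : cocommutative (tpow R n.+1).
Proof.
elim: n => [//|n IH]; exact: (@tens_cocommutative _ R (tpow R n.+1)).
Qed.

(** Composed with the comorphism [tup], the coderivation equation has the coproduct of the tensor
    power replaced by that of [T]. *)
Lemma tangent_ev (T : coalgebra K) n (w : {linear tpow R n.+1 -> R})
    (s : seq {linear T -> R}) :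
    cocommutative T -> coder (rack_pow R n.+1) w ->
    all (@comorphisms _ _ _) s -> size s = n.+1 ->
  tangent (opr (@conv _ _ _) s) (ev w s).
Proof.
move=> Tc dw Ms sn; rewrite /tangent -(rack_pow_tup sn) /ev.
rewrite -!(tmap_cv _ _ (tup n.+1 s)) -(comorphism_tup Tc Ms sn).
by apply: linear_ext => t; exact: dw.
Qed.

(** This is [tan_cob] at the generic point with the identity as prefix: there [opr] becomes
    [rack_pow] and tangency is the coderivation equation. *)
Lemma coder_coboundary n (w : {linear tpow R n.+1 -> R}) :
  coder (rack_pow R n.+1) w -> coder (rack_pow R n.+2) (coboundary w).
Proof.
move=> dw; have Tc := @tpow_cocommutative n.+1.
have Ms := comorphisms_projs n.+1; have sn := size_projs n.+1.
have := @tan_cob _ _ (@conv K (tpow R n.+2) R) (@comorphisms _ _ _)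
  (@comorphisms_conv _ _ Tc R) (@conv_selfdistr _ _ Tc R) (@tangent _ _ R)
  (@tangentB _ _ R) (@tangent_convl _ _ Tc R) (@tangent_convr _ _ Tc R)
  id (ev w) (projs n.+1).
rewrite -(ev_coboundary Tc w Ms sn) -(rack_pow_tup sn) /ev tup_projs sn => H.
have {}H := H (conj (fun _ _ => erefl) (fun _ => id)) isT Ms
  (fun u Mu su => tangent_ev Tc dw Mu su).
by move=> c; exact: (congr1 (fun f : {linear _ -> tens R R} => f c) H).
Qed.

Lemma coboundary_coboundary n (w : {linear tpow R n.+1 -> R}) z :
  coder (rack_pow R n.+1) w -> coboundary (coboundary w) z = 0.
Proof.
move=> dw; have Tc := @tpow_cocommutative n.+2.
have Ms := comorphisms_projs n.+2; have sn := size_projs n.+2.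
have H : ev (coboundary (coboundary w)) (projs n.+2) = 0.
  rewrite (ev_coboundary Tc _ Ms sn).
  (* The inner coboundary is identified with [cob] only on tuples of comorphisms of the right
     length, hence the use of [eq_cob]. *)
  rewrite (@eq_cob _ _ _ (@comorphisms _ _ _) _ id _
    (cob (@conv _ _ _) id (ev w))) //; first last.
  - exact: (@comorphisms_conv _ _ Tc R).
  - by move=> u Mu; rewrite sn => su; exact: ev_coboundary.
  apply: (@cob_cob _ _ _ (@comorphisms _ _ _) (@convBl _ _ R) (@convBr _ _ R)
    (@comorphisms_conv _ _ Tc R) (@conv_selfdistr _ _ Tc R)
    (@tangent _ _ R)).
  - by move=> m v x y _; exact: tangent_conv_conv.
  - by [].
  - by rewrite sn.
  - by [].
  - by move=> u Mu; rewrite sn => su; exact: tangent_ev.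
have := congr1 (fun f : {linear _ -> R} => f z) H.
by rewrite /ev tup_projs.
Qed.

End Main.

Theorem theorem2p12 (K : comNzRingType) (iota : {rmorphism rat -> K})
    (R : rack_bialgebra K) (R_cocomm : cocommutative R)
    (n : nat) (n_gt0 : (0 < n)%N) :
  (forall w : {linear tpow R n -> R},
     coder (rack_pow R n) w -> coder (rack_pow R n.+1) (coboundary w)) /\
  (forall w : {linear tpow R n -> R},
     coder (rack_pow R n) w ->
     forall z : tpow R n.+2, coboundary (coboundary w) z = 0).
Proof.
case: n n_gt0 => // n _; split=> w dw; first exact: coder_coboundary.
by move=> z; exact: coboundary_coboundary.
Qed.
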